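(* Let $(E_0,E_1)$ and $(H_0,H_1)$ be two pairs of complex Banach spaces such that $E_1$ is densely embedded into $E_0$ with $\|x\|_{E_0}\le \|x\|_{E_1}$ for all $x\in E_1$, and $H_1$ is densely and continuously embedded into $H_0$. For $\theta\in[0,1]$ let $E_\theta=[E_0,E_1]_\theta$ and $H_\theta=[H_0,H_1]_\theta$ be the complex interpolation spaces, and let $B_\theta(0,R)$ denote the open ball of radius $R$ centered at $0$ in $E_\theta$. Let $R>0$ and let $\Phi$ be an analytic map from the ball $B_0(0,R)$ into $H_0$ such that $$\|\Phi(x)\|_{H_0}\le C_0(R)\|x\|_{E_0},\qquad x\in B_0(0,R).$$ Suppose also that $\Phi$ maps the ball $B_1(0,R)$ into $H_1$ and $$\|\Phi(x)\|_{H_1}\le C_1(R)\|x\|_{E_1},\qquad x\in B_1(0,R).$$ Then for every $\theta\in[0,1]$ and every $r\in(0,R)$, $\Phi$ maps the ball $B_\theta(0,r)$ into $H_\theta$, and $$\|\Phi(x)\|_{H_\theta}\le C_0(R)^{1-\theta}C_1(R)^{\theta}\,\frac{R}{R-r}\,\|x\|_{E_\theta},\qquad x\in B_\theta(0,r).$$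
   Context: Complex interpolation: for a pair $(X_0,X_1)$ of Banach spaces with $X_1$ continuously embedded in $X_0$, let $\mathcal F(X_0,X_1)$ be the space of bounded functions $f$ on the closed strip $\{0\le \operatorname{Re} z\le 1\}$ with values in $X_0$, continuous on the closed strip and analytic in the open strip $\{0<\operatorname{Re} z<1\}$, such that $t\mapsto f(it)$ is continuous into $X_0$, $f(1+it)\in X_1$ for all real $t$ with $t\mapsto f(1+it)$ continuous into $X_1$, and $\|f(it)\|_{X_0}\to 0$, $\|f(1+it)\|_{X_1}\to0$ as $|t|\to\infty$; it is normed by $\|f\|_{\mathcal F}=\max\{\sup_t\|f(it)\|_{X_0},\sup_t\|f(1+it)\|_{X_1}\}$. Then $[X_0,X_1]_\theta=\{f(\theta): f\in\mathcal F(X_0,X_1)\}$ with norm $\|x\|_{[X_0,X_1]_\theta}=\inf\{\|f\|_{\mathcal F}: f(\theta)=x\}$. Analyticity of $\Phi$ is in the usual sense for maps between complex Banach spaces (locally given by convergent series of homogeneous polynomials, equivalently complex Fréchet differentiable). *)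

(* Defs.v *)
From HB Require Import structures.
From mathcomp Require Import all_boot all_order all_algebra.
From mathcomp Require Import all_classical all_reals all_analysis.
From mathcomp.real_closed Require Import complex.
Set Implicit Arguments.
Unset Strict Implicit.
Unset Printing Implicit Defensive.
Import Order.TTheory GRing.Theory Num.Theory.
Import numFieldNormedType.Exports.
Local Open Scope ring_scope.
Local Open Scope classical_set_scope.

(* The complex field R[i] as a normed module over itself (the library only
   provides these instances generically, which unification does not find for
   the concrete head constant `complex`). *)
HB.instance Definition _ (R : realType) := PseudoPointedMetric.copy R[i] R[i]^o.
HB.instance Definition _ (R : realType) := GRing.ComAlgebra.copy R[i] R[i]^o.
HB.instance Definition _ (R : realType) := Vector.copy R[i] R[i]^o.
HB.instance Definition _ (R : realType) := NormedModule.copy R[i] R[i]^o.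

(* A complex Banach space is a [completeNormedModType R[i]].  Its norm is
   valued in R[i] (and is real); [nrm] is the real-valued norm. *)
Definition nrm (R : realType) (X : normedModType R[i]) (x : X) : R :=
  complex.Re `|x|.

Section Interpolation.
Variable R : realType.
Variables (X0 X1 : completeNormedModType R[i]).
(* X1 is embedded in X0 through the (injective, linear) map j. *)
Variable j : X1 -> X0.

Definition strip : set R[i] := [set z | 0 <= complex.Re z <= 1].
Definition ostrip : set R[i] := [set z | 0 < complex.Re z < 1].

Definition in_F (f : R[i] -> X0) : Prop :=
  [/\ (exists M : R, forall z, strip z -> nrm (f z) <= M),
      {within strip, continuous f},
      (forall z, ostrip z -> differentiable f z),
      continuous (fun t : R => f (Complex 0 t)) &
      (forall e : R, 0 < e -> exists M : R, forall t : R,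
          M < `|t| -> nrm (f (Complex 0 t)) < e)] /\
  exists g : R -> X1,
    [/\ forall t, j (g t) = f (Complex 1 t),
        continuous g &
        forall e : R, 0 < e -> exists M : R, forall t : R,
          M < `|t| -> nrm (g t) < e].

(* the norm of F(X0,X1): max of the two boundary suprema; the X1-norm of
   f(1+it) is the norm of its (unique, j being injective) preimage *)
Definition F_norm (f : R[i] -> X0) : \bar R :=
  maxe (ereal_sup [set (nrm (f (Complex 0 t)))%:E | t in [set: R]])
       (ereal_sup [set (nrm y)%:E | y in
                     [set y : X1 | exists t : R, j y = f (Complex 1 t)]]).

Definition interp_mem (theta : R) (x : X0) : Prop :=
  exists f, in_F f /\ f (theta%:C)%C = x.

Definition interp_norm (theta : R) (x : X0) : \bar R :=
  ereal_inf [set F_norm f | f in [set f | in_F f /\ f (theta%:C)%C = x]].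

End Interpolation.

(* Main.v *)
Require Import Defs.
From HB Require Import structures.
From mathcomp Require Import all_boot all_order all_algebra.
From mathcomp Require Import all_classical all_reals all_analysis.
From mathcomp.real_closed Require Import complex.
From mathcomp Require Import ring lra zify.
Import Order.TTheory GRing.Theory Num.Theory.
Import numFieldNormedType.Exports.
Local Open Scope ring_scope.
Local Open Scope classical_set_scope.

(** Given [f] in [F(E0, E1)] with [f(theta) = x] and norm below [Rad], the
    maximum principle on the strip keeps [f] in the ball of [E0], so
    [h(z) = (C1 / C0) ^ (theta - z) Phi(f(z))] is a competitor for [Phi x] with
    norm at most [C0^(1 - theta) C1^theta] times that of [f]; as
    [Rad / (Rad - r) >= 1] this suffices.  The delicate point is that
    [t |-> Phi(f(1 + it))] is continuous into [H1], although [Phi] is analytic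
    only into [H0].  On a disc, let [G] be bounded in [H1] and holomorphic in
    [H0], with Taylor coefficients [v_m] in [H0].  Averaging [z^-m G(z)] over
    the [n]-th roots of unity on [|z| = rho] gives an element [s_m] of [H1] equal
    to [v_m + rho^n v_(m+n) + rho^(2n) v_(m+2n) + ...]; for suitable [rho] and
    [n] depending on [m] this system is inverted in [H1] by a Neumann series, so
    [v_m] lies in [H1] with a uniform bound and [G] is continuous into [H1].

    The complex analysis is done without integrals: contour integrals are
    replaced by averages over dyadic subdivisions, whose differences are
    controlled in the limit by Goursat's bisection argument. *)

(** Membership in [in_F] asks for a trace on the line Re z = 1 that is continuous into [H1], so
    boundedness of [Phi] from [E1] to [H1] does not by itself make Phi(f(z)) admissible. Cauchy
    integrals of G cannot be formed in [H1] beforehand, since regularity of G as an [H1]-valued map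
    is the very question; and a ball of [H1] need not be closed in [H0], so limits taken in [H0] may
    leave it. A finite average of values of G always stays in [H1]. Its price is aliasing: n
    sampling points do not separate frequencies congruent modulo n. The error consists of further
    Taylor coefficients, which yields a linear system for all of them at once, with data in [H1].
    Two demands on the radius compete: s_m is bounded by rho^-m sup |G|, which wants rho near 1,
    while the coupling rho^n + rho^(2n) + ... has to be small. As n is free, rho is fixed first,
    with rho^-m <= 2, and n afterwards, with rho^n <= 1/3. The coupling then sums to at most 1/2, a
    contraction for the supremum over m, and every coefficient has norm at most 4 sup |G|. *)

(** * Real-valued norms *)

(* Decides equalities between signed sums in an abelian group: everything is
   moved to one side and the last summand is cancelled repeatedly. *)
Ltac extract_summand S x :=
  match S with
  | _ => let _ := match goal with _ => unify S x end in
    constr:(esym (add0r x) : S = 0 + x)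
  | ?A + ?b => let _ := match goal with _ => unify b x end in
    constr:(erefl S : S = A + x)
  | ?A + ?b =>
    let pf := extract_summand A x in
    constr:(etrans (congr1 (fun y => y + b) pf) (addrAC _ x b))
  end.

Ltac zmod :=
  apply/eqP; rewrite -subr_eq0; apply/eqP; rewrite ?(opprD, opprK, addrA);
  repeat (first
    [ rewrite subrr | rewrite addNr
    | match goal with
      | |- ?S - ?x = 0 => let pf := extract_summand S x in
        refine (etrans (congr1 (fun y => y - x) pf) _); rewrite addrK
      | |- ?S + ?x = 0 => let pf := extract_summand S (- x) in
        refine (etrans (congr1 (fun y => y + x) pf) _); rewrite subrK
      end
    | rewrite add0r | rewrite addr0 | rewrite oppr0 ]);
  done.

Section RealNorm.
Context {R : realType}.
Implicit Types X : normedModType R[i].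

Lemma nrmE X (x : X) : `|x| = ((nrm x)%:C)%C.
Proof. by rewrite /nrm RRe_real// ger0_real. Qed.

Lemma nrm_ge0 X (x : X) : 0 <= nrm x.
Proof. by rewrite -ler0c -nrmE. Qed.

Lemma nrm0 X : nrm (0 : X) = 0.
Proof. by apply: complexI; rewrite -nrmE normr0. Qed.

Lemma nrm_eq0 X (x : X) : nrm x = 0 -> x = 0.
Proof. by move=> x0; apply/eqP; rewrite -normr_eq0 nrmE x0. Qed.

Lemma nrm_gt0 X (x : X) : x != 0 -> 0 < nrm x.
Proof. by move=> x0; rewrite -ltcR -nrmE normr_gt0. Qed.

Lemma nrmD X (x y : X) : nrm (x + y) <= nrm x + nrm y.
Proof. by rewrite -lecR rmorphD/= -!nrmE ler_normD. Qed.

Lemma ler_nrmD X (x y : X) (a b : R) :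
  nrm x <= a -> nrm y <= b -> nrm (x + y) <= a + b.
Proof. by move=> xa yb; rewrite (le_trans (nrmD _ _ _))// lerD. Qed.

Lemma nrmN X (x : X) : nrm (- x) = nrm x.
Proof. by apply: complexI; rewrite -!nrmE normrN. Qed.

Lemma nrmB X (x y : X) : nrm (x - y) <= nrm x + nrm y.
Proof. by rewrite -(nrmN X y) nrmD. Qed.

Lemma ler_nrmB X (x y : X) (a b : R) :
  nrm x <= a -> nrm y <= b -> nrm (x - y) <= a + b.
Proof. by move=> xa yb; rewrite (le_trans (nrmB _ _ _))// lerD. Qed.

Lemma nrmBC X (x y : X) : nrm (x - y) = nrm (y - x).
Proof. by rewrite -nrmN opprB. Qed.

Lemma nrmZ X (a : R[i]) (x : X) : nrm (a *: x) = nrm a * nrm x.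
Proof. by apply: complexI; rewrite rmorphM/= -!nrmE normrZ. Qed.

Lemma nrmM (a b : R[i]) : nrm (a * b) = nrm a * nrm b.
Proof. exact: (nrmZ _ a b). Qed.

Lemma nrm_tri X (y x z : X) : nrm (x - z) <= nrm (x - y) + nrm (y - z).
Proof. by rewrite -(subrKA y x (- z)) nrmD. Qed.

Lemma nrm_sub_le X (x y : X) : nrm x - nrm y <= nrm (x - y).
Proof. by rewrite lerBlDr; have := nrmD _ (x - y) y; rewrite subrK. Qed.

Lemma nrmE_complex (z : R[i]) :
  nrm z = Num.sqrt (complex.Re z ^+ 2 + complex.Im z ^+ 2).
Proof. by rewrite /nrm normc_def. Qed.

Lemma nrmR (x : R) : nrm (x%:C)%C = `|x|.
Proof. by rewrite nrmE_complex /= expr0n/= addr0 sqrtr_sqr. Qed.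

Lemma nrm1 : nrm (1 : R[i]) = 1.
Proof. by rewrite -[1]/((1%:C)%C) nrmR normr1. Qed.

Lemma nrmI (y : R) : nrm (Complex 0 y) = `|y|.
Proof. by rewrite nrmE_complex /= expr0n/= add0r sqrtr_sqr. Qed.

Lemma nrmV (z : R[i]) : nrm z^-1 = (nrm z)^-1.
Proof. by apply: complexI; rewrite fmorphV/= -!nrmE normfV. Qed.

Lemma nrmX (z : R[i]) n : nrm (z ^+ n) = nrm z ^+ n.
Proof. by elim: n => [|n IH]; rewrite ?expr0 ?nrm1// !exprS nrmM IH. Qed.

Lemma nrm_neq0 (z : R[i]) : 0 < nrm z -> z != 0.
Proof. by apply: contraTneq => ->; rewrite nrm0 ltxx. Qed.

Lemma ler_Re_nrm (z : R[i]) : `|complex.Re z| <= nrm z.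
Proof. by rewrite nrmE_complex -sqrtr_sqr ler_wsqrtr// lerDl sqr_ge0. Qed.

Lemma ler_Im_nrm (z : R[i]) : `|complex.Im z| <= nrm z.
Proof. by rewrite nrmE_complex -sqrtr_sqr ler_wsqrtr// lerDr sqr_ge0. Qed.

Lemma complexED (x y : R) : Complex x y = (x%:C)%C + Complex 0 y.
Proof. by apply/eqP; rewrite eq_complex/= addr0 add0r !eqxx. Qed.

Lemma nrm_complex_le (x y : R) : nrm (Complex x y) <= `|x| + `|y|.
Proof. by rewrite complexED (le_trans (nrmD _ _ _))// nrmR nrmI. Qed.

Lemma cvg_nrm X T (F : set_system T) {FF : Filter F} (f : T -> X) (l : X) :
  (f @ F --> l) <-> forall e : R, 0 < e -> \forall t \near F, nrm (f t - l) < e.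
Proof.
split=> [/cvgrPdist_lt fl e e0|fl].
  have /fl : 0 < (e%:C)%C by rewrite ltcR.
  by apply: filterS => t; rewrite nrmE ltcR nrmBC.
apply/cvgrPdist_lt => e e0.
have eE : e = ((complex.Re e)%:C)%C by rewrite RRe_real// gtr0_real.
have /fl : 0 < complex.Re e by rewrite -ltcR -eE.
by apply: filterS => t; rewrite eE nrmE ltcR nrmBC.
Qed.

Lemma nbhs_nrm X (x : X) (P : set X) :
  (\forall y \near x, P y) <->
  exists2 d : R, 0 < d & forall y, nrm (y - x) < d -> P y.
Proof.
split.
  move=> /nbhs_ballP[d /= d0 dP].
  have dE : d = ((complex.Re d)%:C)%C by rewrite RRe_real// gtr0_real.
  exists (complex.Re d); first by rewrite -ltcR -dE.
  by move=> y yd; apply: dP; rewrite -ball_normE/= dE nrmE ltcR nrmBC.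
move=> [d d0 dP]; apply/nbhs_ballP; exists (d%:C)%C; first by rewrite /= ltcR.
by move=> y; rewrite -ball_normE/= nrmE ltcR nrmBC; exact: dP.
Qed.

Lemma cauchy_nrm_cvg (X : completeNormedModType R[i]) (u : nat -> X) :
  (forall e : R, 0 < e ->
     exists N, forall m n, (N <= m)%N -> (N <= n)%N -> nrm (u m - u n) < e) ->
  exists l : X, forall e : R, 0 < e -> \forall n \near \oo, nrm (u n - l) < e.
Proof.
move=> cu; suff /cvg_ex[l] : cvgn u.
  by move=> ul; exists l; exact: (cvg_nrm _ _ _ u l).1.
apply/cauchy_cvgP/cauchy_ballP => e e0.
have eE : e = ((complex.Re e)%:C)%C by rewrite RRe_real// gtr0_real.
have /cu[N uN] : 0 < complex.Re e by rewrite -ltcR -eE.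
rewrite near_simpl; exists ([set n | (N <= n)%N], [set n | (N <= n)%N]).
  by split; exists N.
by move=> [m n] [/= Nm Nn]; rewrite -ball_normE/= eE nrmE ltcR; exact: uN.
Qed.

Lemma nrm_near_le X (u : nat -> X) (l : X) (c : R) :
  (forall e : R, 0 < e -> \forall n \near \oo, nrm (u n - l) < e) ->
  (\forall n \near \oo, nrm (u n) <= c) -> nrm l <= c.
Proof.
move=> ul uc; apply/ler_addgt0Pr => e e0.
have [n [/= h1 h2]] := filter_ex (filterI (ul _ e0) uc).
by have := nrm_sub_le _ l (u n); rewrite nrmBC; lra.
Qed.

Lemma nrm_lim_uniq X (u : nat -> X) (l l' : X) :
  (forall e : R, 0 < e -> \forall n \near \oo, nrm (u n - l) < e) ->
  (forall e : R, 0 < e -> \forall n \near \oo, nrm (u n - l') < e) -> l = l'.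
Proof.
move=> ul ul'; apply/eqP; rewrite -subr_eq0; apply/eqP/nrm_eq0/eqP.
rewrite eq_le nrm_ge0 andbT; apply/ler_addgt0Pr => e e0; rewrite add0r.
have e2 : 0 < e / 2 by rewrite divr_gt0.
have [n [/= h1 h2]] := filter_ex (filterI (ul _ e2) (ul' _ e2)).
by have := nrm_tri _ (u n) l l'; rewrite (nrmBC _ l (u n)); lra.
Qed.

Lemma near_geometric_lt (C q e : R) : 0 <= q < 1 -> 0 < e ->
  \forall n \near \oo, C * q ^+ n < e.
Proof.
move=> /andP[q0 q1] e0; have : (C * q ^+ n @[n --> \oo]) --> C * 0.
  by apply: cvgMr; apply: cvg_expr; rewrite ger0_norm.
rewrite mulr0 => /cvgrPdist_lt/(_ _ e0); apply: filterS => n.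
by rewrite sub0r normrN => /ltr_normlW.
Qed.

End RealNorm.

(** * Complex differentiability and the exponential *)

(** The product rule in remainder form, for an increment [D]: the first two terms carry the
    first-order remainders of the factors, the third is of second order. *)
Lemma scaler_product_expansion (K : comNzRingType) (V : lmodType K)
    (a b a' D : K) (x y y' : V) :
  b *: y - a *: x - D *: (a' *: x + a *: y') =
  (b - a - D * a') *: x + b *: (y - x - D *: y') + D *: ((b - a) *: y').
Proof.
by rewrite !(mulrBr, scalerBl, scalerBr, scalerDr, scalerA) [b * D]mulrC; zmod.
Qed.

Section ComplexDerivative.
Context {R : realType}.
Implicit Types X : normedModType R[i].

(** Multiplying the difference quotient out removes the division, so the estimate also holds at
    [w = z]; this is the form that Goursat's argument consumes. *)
Lemma differentiable_affine X (f : R[i] -> X) z : differentiable f z ->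
  exists d : X, forall e : R, 0 < e ->
    \forall w \near z, nrm (f w - f z - (w - z) *: d) <= e * nrm (w - z).
Proof.
move=> /derivable1_diffP/cvg_ex[d /= fd]; exists d => e e0.
move: fd => /(cvg_nrm _ _ _ _ d).1 /(_ _ e0) /nbhs_nrm[r r0 rd].
apply/nbhs_nrm; exists r => // w wr.
have [->|wz] := eqVneq w z; first by rewrite !subrr scale0r subr0 !nrm0 mulr0.
have wz0 : w - z != 0 by rewrite subr_eq0.
have := rd (w - z); rewrite subr0 => /(_ wr wz0).
rewrite /= -/(_ *: 1) [_ *: 1]mulr1 subrK => h.
have -> : f w - f z - (w - z) *: d = (w - z) *: ((w - z)^-1 *: (f w - f z) - d).
  by rewrite scalerBr scalerA divff// scale1r.
by rewrite nrmZ mulrC ler_wpM2r ?nrm_ge0// ltW.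
Qed.

Lemma affine_differentiable X (f : R[i] -> X) z (d : X) :
  (forall e : R, 0 < e ->
    \forall w \near z, nrm (f w - f z - (w - z) *: d) <= e * nrm (w - z)) ->
  differentiable f z.
Proof.
move=> fd; apply/derivable1_diffP/cvg_ex; exists d.
apply/(cvg_nrm _ _ _ _ d) => e e0.
have /fd/nbhs_nrm[r r0 rd] : 0 < e / 2 by rewrite divr_gt0.
apply/nbhs_nrm; exists r => // h; rewrite subr0 => hr h0.
have := rd (h + z); rewrite addrK => /(_ hr) {}rd.
rewrite /= [_ *: 1]mulr1.
have -> : h^-1 *: (f (h + z) - f z) - d = h^-1 *: (f (h + z) - f z - h *: d).
  by rewrite [RHS]scalerBr scalerA mulVf// scale1r.
have hp : 0 < nrm h.
  by apply: nrm_gt0.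
rewrite nrmZ nrmV mulrC ltr_pdivrMr//.
by apply: le_lt_trans rd _; rewrite ltr_pM2r//; lra.
Qed.

Lemma near_eq_differentiable X (f h : R[i] -> X) z :
  (\forall w \near z, f w = h w) -> differentiable f z -> differentiable h z.
Proof.
move=> fh /differentiable_affine[d fd]; apply: (affine_differentiable _ _ _ d) => e e0.
apply: filterS (filterI fh (fd _ e0)) => w [<-].
by rewrite -(nbhs_singleton fh).
Qed.

Lemma differentiable_nrm_near X (f : R[i] -> X) z : differentiable f z ->
  forall e : R, 0 < e -> \forall w \near z, nrm (f w - f z) < e.
Proof.
by move=> /differentiable_continuous/(cvg_nrm _ _ _ f (f z)).1.
Qed.

Lemma differentiable_scaler X (a : R[i] -> R[i]) (f : R[i] -> X) z :
  differentiable a z -> differentiable f z ->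
  differentiable (fun w => a w *: f w) z.
Proof.
move=> da df; have [a' ha] := differentiable_affine _ _ _ da.
have [f' hf] := differentiable_affine _ _ _ df.
apply: (affine_differentiable _ _ _ (a' *: f z + a z *: f')) => e e0.
(* [K] dominates every factor that multiplies a small quantity below, and [e'] is chosen so that
   each of the three terms gets a third of [e]. *)
pose K := nrm (f z) + nrm (a z) + nrm f' + 2.
have K2 : 2 <= K by rewrite /K; move: (nrm_ge0 _ (f z)) (nrm_ge0 _ (a z)) (nrm_ge0 _ f'); lra.
pose e' := Num.min 1 (e / (3 * K)).
have e'0 : 0 < e' by rewrite lt_min ltr01/= divr_gt0//; lra.
have e'K : e' * K <= e / 3.
  have : e' <= e / (3 * K) by rewrite ge_min lexx orbT.
  rewrite -(ler_pM2r (_ : 0 < K)); last lra.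
  by move/le_trans; apply; rewrite ler_pdivlMr// le_eqVlt; apply/orP; left; apply/eqP; field; lra.
have e'1 : e' <= 1 by rewrite ge_min lexx.
near=> w.
have h1 : nrm (a w - a z - (w - z) *: a') <= e' * nrm (w - z) by near: w; exact: ha.
have h2 : nrm (f w - f z - (w - z) *: f') <= e' * nrm (w - z) by near: w; exact: hf.
have h3 : nrm (a w - a z) < e' by near: w; exact: differentiable_nrm_near.
have -> : a w *: f w - a z *: f z - (w - z) *: (a' *: f z + a z *: f') =
  (a w - a z - (w - z) *: a') *: f z + a w *: (f w - f z - (w - z) *: f')
  + (w - z) *: ((a w - a z) *: f').
  exact: scaler_product_expansion.
have aw : nrm (a w) <= nrm (a z) + 1.
  by have := nrm_sub_le _ (a w) (a z); lra.
have -> : e * nrm (w - z) =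
    e / 3 * nrm (w - z) + e / 3 * nrm (w - z) + e / 3 * nrm (w - z) by field.
have D0 := nrm_ge0 _ (w - z); set D := nrm (w - z) in h1 h2 D0 *.
apply: ler_nrmD; first apply: ler_nrmD; rewrite nrmZ.
-   apply: le_trans (ler_wpM2r (nrm_ge0 _ _) h1) _.
  have : e' * nrm (f z) <= e' * K.
    by rewrite ler_pM2l// /K; move: (nrm_ge0 _ (a z)) (nrm_ge0 _ f'); lra.
  by rewrite mulrAC => h; apply: ler_wpM2r => //; lra.
-   apply: le_trans (ler_wpM2l (nrm_ge0 _ _) h2) _.
  have : nrm (a w) * e' <= K * e'.
    by rewrite ler_pM2r// /K; move: (nrm_ge0 _ (f z)) (nrm_ge0 _ f'); lra.
  by rewrite mulrA => h; apply: ler_wpM2r => //; lra.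
- rewrite nrmZ mulrC; apply: ler_wpM2r => //.
  apply: le_trans (ler_wpM2r (nrm_ge0 _ _) (ltW h3)) _.
  apply: le_trans _ e'K; rewrite ler_pM2l// /K.
  by move: (nrm_ge0 _ (f z)) (nrm_ge0 _ (a z)); lra.
Unshelve. all: by end_near. Qed.

Lemma derive_affine (f : R -> R) (x d : R) : is_derive x 1 f d ->
  forall e : R, 0 < e ->
    \forall h \near 0, `|f (h + x) - f x - h * d| <= e * `|h|.
Proof.
move=> [/cvg_ex[l fl] fd] e e0.
have ld : l = d by rewrite -fd; apply/esym/cvg_lim.
move: fl; rewrite ld => /cvgrPdist_lt/(_ _ e0)/nbhs_ballP[r /= r0 rd].
apply/nbhs_ballP; exists r => // h hr.
have [->|h0] := eqVneq h 0; first by rewrite add0r subrr mul0r subr0 normr0 mulr0.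
have := rd h hr h0; rewrite /= [_ *: 1]mulr1 => /ltW hd.
have -> : f (h + x) - f x - h * d = - (h * (d - h^-1 *: (f (h + x) - f x))).
  by rewrite mulrBr -[h^-1 *: _]/(h^-1 * _) mulrA divff// mul1r opprB.
by rewrite normrN normrM mulrC ler_wpM2r.
Qed.

Definition cis (t : R) : R[i] := Complex (cos t) (sin t).

Lemma cisD s t : cis (s + t) = cis s * cis t.
Proof.
by apply/eqP; rewrite eq_complex /= cosD sinD [cos s * sin t + _]addrC !eqxx.
Qed.

Lemma nrm_cis t : nrm (cis t) = 1.
Proof. by rewrite nrmE_complex /= cos2Dsin2 sqrtr1. Qed.

Lemma cis0 : cis 0 = 1.
Proof. by rewrite /cis cos0 sin0. Qed.

Lemma cispi : cis pi = -1.
Proof. by apply/eqP; rewrite eq_complex /= cospi sinpi oppr0 !eqxx. Qed.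

Lemma cis2pi : cis (2 * pi) = 1.
Proof. by rewrite mulr2n mulrDl mul1r cisD cispi mulrNN mulr1. Qed.

Lemma cisX t n : cis t ^+ n = cis (n%:R * t).
Proof.
by elim: n => [|n IH]; rewrite ?mul0r ?cis0// exprS IH -cisD -nat1r mulrDl mul1r.
Qed.

Definition cexp (w : R[i]) : R[i] := ((expR (complex.Re w))%:C)%C * cis (complex.Im w).

Lemma cexpD w z : cexp (w + z) = cexp w * cexp z.
Proof.
case: w z => [a b] [c d]; rewrite /cexp /= expRD cisD rmorphM /=.
by rewrite mulrACA.
Qed.

Lemma nrm_cexp w : nrm (cexp w) = expR (complex.Re w).
Proof. by rewrite nrmM nrm_cis mulr1 nrmR ger0_norm// expR_ge0. Qed.

Lemma cexp0 : cexp 0 = 1.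
Proof. by rewrite /cexp /= expR0 cis0 mulr1. Qed.

(** The derivative at 0 comes from the real derivatives of exp, cos and sin; the addition law
    carries it to every other point. *)
Lemma cexp_near0 e : 0 < e ->
  \forall k \near (0 : R[i]), nrm (cexp k - 1 - k) <= e * nrm k.
Proof.
move=> e0; pose e' := Num.min 1 (e / 6).
have e'0 : 0 < e' by rewrite lt_min ltr01/= divr_gt0.
have e'1 : e' <= 1 by rewrite ge_min lexx.
have e'6 : e' <= e / 6 by rewrite ge_min lexx orbT.
clearbody e'.
have [r1 /= r10 H1] := (nbhs_ballP _ _).1 (derive_affine _ _ _ (is_derive_expR 0) _ e'0).
have [r2 /= r20 H2] := (nbhs_ballP _ _).1 (derive_affine _ _ _ (is_derive_cos 0) _ e'0).
have [r3 /= r30 H3] := (nbhs_ballP _ _).1 (derive_affine _ _ _ (is_derive_sin 0) _ e'0).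
apply/nbhs_nrm; exists (Num.min (Num.min r1 e') (Num.min r2 r3)).
  by rewrite !lt_min r10 r20 r30 e'0.
move=> [x y]; rewrite subr0 !lt_min => /andP[/andP[k1 ke] /andP[k2 k3]].
have xk := ler_Re_nrm (Complex x y); have yk := ler_Im_nrm (Complex x y).
rewrite /= in xk yk.
have {}H1 : `|expR x - 1 - x| <= e' * `|x|.
  have := H1 x; rewrite /ball/= sub0r normrN addr0 expR0 mulr1; apply; lra.
have {}H2 : `|cos y - 1| <= e' * `|y|.
  have := H2 y; rewrite /ball/= sub0r normrN addr0 cos0 sin0 oppr0 mulr0 subr0; apply; lra.
have {}H3 : `|sin y - y| <= e' * `|y|.
  have := H3 y; rewrite /ball/= sub0r normrN addr0 sin0 cos0 mulr1 subr0; apply; lra.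
(* The three terms are the remainder of exp, (1 + x) times the remainder of [cis], and the cross
   term i x y. They cost 1, 4 and 1 shares of [e / 6]. *)
have -> : cexp (Complex x y) - 1 - Complex x y =
  ((expR x - 1 - x)%:C)%C * cis y + ((1 + x)%:C)%C * Complex (cos y - 1) (sin y - y)
  + (x%:C)%C * Complex 0 y.
  by apply/eqP; rewrite eq_complex /=; apply/andP; split; apply/eqP; ring.
set D := nrm (Complex x y) in k1 ke k2 k3 xk yk *.
have D0 : 0 <= D by exact: nrm_ge0.
have b1 : `|expR x - 1 - x| <= e / 6 * D.
  by apply: le_trans H1 _; apply: ler_pM => //; exact: ltW.
have b2 : `|1 + x| * nrm (Complex (cos y - 1) (sin y - y)) <= 2 * (2 * (e / 6 * D)).
  apply: ler_pM => //; first exact: nrm_ge0.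
    by apply: le_trans (ler_normD _ _) _; rewrite normr1; lra.
  apply: le_trans (nrm_complex_le _ _) _.
  have : e' * `|y| <= e / 6 * D by apply: ler_pM => //; exact: ltW.
  by lra.
have b3 : `|x| * `|y| <= e / 6 * D.
  by apply: ler_pM => //; lra.
have -> : e * D = e / 6 * D + 2 * (2 * (e / 6 * D)) + e / 6 * D by field.
by apply: ler_nrmD; first apply: ler_nrmD; rewrite nrmM nrmR ?nrmI ?nrm_cis ?mulr1.
Qed.

Lemma differentiable_cexp z : differentiable cexp z.
Proof.
apply: (affine_differentiable _ _ _ (cexp z)) => e e0.
have c0 : 0 < nrm (cexp z) by rewrite nrm_cexp expR_gt0.
have /cexp_near0/nbhs_nrm[r r0 rP] : 0 < e / nrm (cexp z) by rewrite divr_gt0.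
apply/nbhs_nrm; exists r => // w wr.
have := rP (w - z); rewrite subr0 => /(_ wr) {}rP.
have -> : cexp w - cexp z - (w - z) *: cexp z = cexp z * (cexp (w - z) - 1 - (w - z)).
  by rewrite -{1}(subrK z w) cexpD -[_ *: _]/(_ * _); ring.
by rewrite nrmM -ler_pdivlMl// mulrA [X in _ <= X * _]mulrC.
Qed.

End ComplexDerivative.

(** * Dyadic averages and Goursat's lemma *)

Section DyadicAverage.
Context {R : realType}.

(* The average of [h] over the points [a + k s / 2^p], [k < 2^p]. *)
Fixpoint davg (K : numFieldType) (V : lmodType K) (p : nat) (h : R -> V) (a s : R) : V :=
  if p is p'.+1 then
    2^-1 *: (davg K V p' h a (s / 2) + davg K V p' h (a + s / 2) (s / 2))
  else h a.
Arguments davg {K V}.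

Section Linear.
Variables (K : numFieldType) (V : lmodType K).
Implicit Types h : R -> V.

Lemma eq_davg p h h' a s : h =1 h' -> davg p h a s = davg p h' a s.
Proof. by move=> hh'; elim: p a s => [|p IH] a s /=; rewrite ?hh'// !IH. Qed.

Lemma davgD p h h' a s :
  davg p (fun t => h t + h' t) a s = davg p h a s + davg p h' a s.
Proof. by elim: p a s => [//|p IH] a s /=; rewrite !IH -scalerDr addrACA. Qed.

Lemma davgZ p k h a s : davg p (fun t => k *: h t) a s = k *: davg p h a s.
Proof.
by elim: p a s => [//|p IH] a s /=; rewrite !IH -scalerDr !scalerA [_ * k]mulrC.
Qed.

Lemma davgB p h h' a s :
  davg p (fun t => h t - h' t) a s = davg p h a s - davg p h' a s.
Proof.
rewrite -[- davg p h' a s]scaleN1r -davgZ -davgD.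
by apply: eq_davg => t; rewrite scaleN1r.
Qed.

Lemma davg_cst p (c : V) a s : davg p (fun=> c) a s = c.
Proof.
elim: p a s => [//|p IH] a s /=; rewrite !IH -mulr2n -(scaler_nat 2 c) scalerA.
by rewrite mulVf ?scale1r// pnatr_eq0.
Qed.

Lemma davg_scalel p (k : R -> K) (v : V) a s :
  davg p (fun t => k t *: v) a s = davg p (V := K^o) k a s *: v.
Proof.
by elim: p a s => [//|p IH] a s /=; rewrite !IH -scalerDl scalerA.
Qed.

Lemma davg_sum p (F : nat -> R -> V) n a s :
  davg p (fun t => \sum_(k < n) F k t) a s = \sum_(k < n) davg p (F k) a s.
Proof.
elim: n => [|n IH].
  by rewrite big_ord0 -{2}(davg_cst p 0 a s); apply: eq_davg => t; rewrite big_ord0.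
by rewrite big_ord_recr/= -IH -davgD; apply: eq_davg => t; rewrite big_ord_recr.
Qed.

Lemma davg_shift p h a c s : davg p h (a + c) s = davg p (fun t => h (t + c)) a s.
Proof. by elim: p a s => [//|p IH] a s /=; rewrite addrAC !IH. Qed.

Lemma davg_dilation p h c a s :
  davg p h (c * a) (c * s) = davg p (fun t => h (c * t)) a s.
Proof. by elim: p a s => [//|p IH] a s /=; rewrite -mulrA -mulrDr !IH. Qed.

(** Together with [davg_periodic] this evaluates the trigonometric averages used later: the two
    halves of the grid cancel or coincide, and no sum over roots of unity is computed. *)
Lemma davg_antiperiodic p h a s : (forall t, h (t + s / 2) = - h t) ->
  davg p.+1 h a s = 0.
Proof.
move=> hN /=; rewrite davg_shift (eq_davg _ (fun t => h (t + _)) (fun t => 0 - h t)); last first.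
  by move=> t; rewrite hN sub0r.
by rewrite davgB davg_cst sub0r subrr scaler0.
Qed.

Lemma davg_periodic p h a s : (forall t, h (t + s / 2) = h t) ->
  davg p.+1 h a s = davg p h a (s / 2).
Proof.
move=> hN /=; rewrite davg_shift (eq_davg _ (fun t => h (t + _)) h)//.
by rewrite -mulr2n -(scaler_nat 2 (davg _ _ _ _)) scalerA mulVf ?scale1r// pnatr_eq0.
Qed.

End Linear.

Lemma davg_le p (h h' : R -> R) a s : 0 <= s ->
  (forall t, a <= t <= a + s -> h t <= h' t) ->
  davg p (V := R^o) h a s <= davg p (V := R^o) h' a s.
Proof.
elim: p a s => [|p IH] a s s0 hh'.
  by apply: hh'; rewrite lexx/= lerDl.
rewrite /= -![_ *: _]/(_ * _) ler_pM2l ?invr_gt0//.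
by apply: lerD; apply: IH => [|t tas]; (try lra); apply: hh'; lra.
Qed.

Lemma nrm_davg (X : normedModType R[i]) p (h : R -> X) a s :
  nrm (davg p h a s) <= davg p (V := R^o) (fun t => nrm (h t)) a s.
Proof.
elim: p a s => [//|p IH] a s /=.
rewrite nrmZ nrmV -[2]/(2%:R) -(rmorph_nat (real_complex R)) nrmR normr_nat.
by rewrite -[X in _ <= X]/(_ * _) ler_pM2l ?invr_gt0// ler_nrmD.
Qed.

Lemma nrm_davg_le (X : normedModType R[i]) p (h : R -> X) a s c : 0 <= s ->
  (forall t, a <= t <= a + s -> nrm (h t) <= c) -> nrm (davg p h a s) <= c.
Proof.
move=> s0 hc; apply: le_trans (nrm_davg X p h a s) _.
by rewrite -[leRHS](@davg_cst R R^o p c a s); exact: davg_le.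
Qed.

End DyadicAverage.
Arguments davg {R K V}.

Lemma contour_subdivision (K : numFieldType) (V : lmodType K) (a b : K)
    (B1 B2 M1 M2 T1 T2 L1 L2 C1 C2 R1 R2 : V) :
  (a + a) *: (2^-1 *: (B1 + B2) - 2^-1 *: (T1 + T2)) +
  (b + b) *: (2^-1 *: (R1 + R2) - 2^-1 *: (L1 + L2)) =
  (a *: (B1 - M1) + b *: (C1 - L1)) + (a *: (B2 - M2) + b *: (R1 - C1)) +
  (a *: (M1 - T1) + b *: (C2 - L2)) + (a *: (M2 - T2) + b *: (R2 - C2)).
Proof.
have half (k : K) : (k + k) * 2^-1 = k by rewrite mulrDl -splitr.
rewrite -!scalerBr !scalerA !half.
by rewrite !(scalerBr, scalerDr); zmod.
Qed.

Lemma contour_affine (K : comNzRingType) (V : lmodType K) (a b w : K) (c d : V) :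
  a *: ((c + w *: d) - (c + (w + b) *: d)) +
  b *: ((c + (w + a) *: d) - (c + w *: d)) = 0.
Proof.
have cK (x y : V) : (c + x) - (c + y) = x - y.
  by rewrite opprD addrACA subrr add0r.
rewrite !cK -!scalerBl opprD addrA subrr add0r.
by rewrite addrAC subrr add0r !scalerA mulrN scaleNr [b * a]mulrC addNr.
Qed.

Lemma remainder_expansion (K : comNzRingType) (V : lmodType K) (a b : K)
    (h1 h2 h3 h4 l1 l2 l3 l4 : V) :
  a *: (l1 - l2) + b *: (l3 - l4) = 0 ->
  a *: (h1 - h2) + b *: (h3 - h4) =
  a *: ((h1 - l1) - (h2 - l2)) + b *: ((h3 - l3) - (h4 - l4)).
Proof.
move=> l0; rewrite -[LHS]subr0 -{1}l0.
by rewrite !(scalerBr, scalerDr); zmod.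
Qed.

Section Goursat.
Context {R : realType} (X : normedModType R[i]).
Implicit Types h : R[i] -> X.

(* Riemann sum of the integral of [h] along the boundary of the rectangle with
   lower left corner [x + i y], width [s] and height [u]. *)
Definition contour p h (x y s u : R) : X :=
  (s%:C)%C *: (davg p (fun t => h (Complex t y)) x s
             - davg p (fun t => h (Complex t (y + u))) x s) +
  Complex 0 u *: (davg p (fun t => h (Complex (x + s) t)) y u
                - davg p (fun t => h (Complex x t)) y u).

(** The grids are dyadic, so the halves of the outer sides join exactly, and each inner side is
    traversed twice in opposite directions on the same grid. The additivity is therefore an identity
    at every finite level. *)
Lemma contourS p h x y s u : contour p.+1 h x y s u =
  contour p h x y (s / 2) (u / 2) + contour p h (x + s / 2) y (s / 2) (u / 2) +
  contour p h x (y + u / 2) (s / 2) (u / 2) +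
  contour p h (x + s / 2) (y + u / 2) (s / 2) (u / 2).
Proof.
have dbl (c v : R) : c + v / 2 + v / 2 = c + v by lra.
rewrite /contour !dbl /=.
have -> : (s%:C)%C = ((s / 2)%:C)%C + ((s / 2)%:C)%C :> R[i].
  by rewrite -rmorphD/= -splitr.
have -> : Complex 0 u = Complex 0 (u / 2) + Complex 0 (u / 2).
  by apply/eqP; rewrite eq_complex /= addr0 -splitr !eqxx.
exact: contour_subdivision.
Qed.

(** Exact at every level and not only in the limit: for [p = 0] the two first-order terms are the
    same product of side lengths with opposite signs, and subdivision propagates this. *)
Lemma contour_affine0 p (c d : X) (w0 : R[i]) x y s u :
  contour p (fun w => c + (w - w0) *: d) x y s u = 0.
Proof.
elim: p x y s u => [|p IH] x y s u; last by rewrite contourS !IH !addr0.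
rewrite /contour /=.
have -> : Complex x (y + u) - w0 = (Complex x y - w0) + Complex 0 u.
  by case: w0 => a b; apply/eqP; rewrite eq_complex /=; apply/andP; split; apply/eqP; ring.
have -> : Complex (x + s) y - w0 = (Complex x y - w0) + (s%:C)%C.
  by case: w0 => a b; apply/eqP; rewrite eq_complex /=; apply/andP; split; apply/eqP; ring.
exact: contour_affine.
Qed.

Lemma nrm_contour_le p h c x y s u : 0 <= s -> 0 <= u ->
  (forall x' y', x <= x' <= x + s -> y <= y' <= y + u ->
     nrm (h (Complex x' y')) <= c) ->
  nrm (contour p h x y s u) <= 2 * (s + u) * c.
Proof.
move=> s0 u0 hc; have -> : 2 * (s + u) * c = s * (c + c) + u * (c + c) by ring.
apply: ler_nrmD; rewrite nrmZ ?nrmR ?nrmI ger0_norm//; apply: ler_wpM2l => //;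
  apply: ler_nrmB; apply: nrm_davg_le => // t tI; apply: hc; lra.
Qed.

Lemma contour_remainder p h (c d : X) (w0 : R[i]) x y s u :
  contour p h x y s u = contour p (fun w => h w - (c + (w - w0) *: d)) x y s u.
Proof.
rewrite {2}/contour !davgB; apply: remainder_expansion.
exact: contour_affine0 p c d w0 x y s u.
Qed.

Lemma nested_intervals (a : nat -> R) (s : R) : 0 <= s ->
  (forall k, a k <= a k.+1 /\ a k.+1 + s / 2 ^+ k.+1 <= a k + s / 2 ^+ k) ->
  exists l, forall k, a k <= l <= a k + s / 2 ^+ k.
Proof.
move=> s0 aI.
have mono k n : a k <= a (n + k)%N /\ a (n + k)%N + s / 2 ^+ (n + k) <= a k + s / 2 ^+ k.
  elim: n => [|n [IH1 IH2]]; first by rewrite add0n.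
  by have [h1 h2] := aI (n + k)%N; rewrite addSn; lra.
have pos k : 0 <= s / 2 ^+ k by rewrite divr_ge0// exprn_ge0.
have ub k : ubound (range a) (a k + s / 2 ^+ k).
  move=> _ [n _ <-]; have [kn|/ltnW nk] := leqP k n.
    by have := mono k (n - k)%N; rewrite subnK// => -[]; move: (pos n); lra.
  by have := mono n (k - n)%N; rewrite subnK// => -[]; move: (pos k); lra.
have hs : has_sup (range a).
  by split; [exists (a 0%N), 0%N | exists (a 0%N + s / 2 ^+ 0)].
exists (sup (range a)) => k; apply/andP; split.
  by apply: sup_upper_bound => //; exists k.
by apply: ge_sup => //; exists (a 0%N), 0%N.
Qed.

Lemma goursat h x y s u : 0 < s -> 0 < u ->
  (forall x' y', x <= x' <= x + s -> y <= y' <= y + u ->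
     differentiable h (Complex x' y')) ->
  forall e : R, 0 < e -> \forall p \near \oo, nrm (contour p h x y s u) <= e.
Proof.
move=> s0 u0 dh e e0.
pose sz (v : R) k := v / 2 ^+ k.
(* The budget is divided by 4 with each bisection, so that four good quarters make a good
   rectangle. *)
pose good k (q : R * R) := \forall p \near \oo,
  nrm (contour p h q.1 q.2 (sz s k) (sz u k)) <= e / 4 ^+ k.
have sz2 v k : sz v k / 2 = sz v k.+1.
  by rewrite /sz exprSr invfM mulrA.
have sz0 v k : 0 < v -> 0 < sz v k by move=> v0; rewrite /sz divr_gt0 ?exprn_gt0.
suff : good 0%N (x, y) by rewrite /good /sz /= !expr0 !divr1.
apply: contrapT => bad0.
have step k (q : R * R) : exists q' : R * R, (~ good k q -> ~ good k.+1 q') /\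
    [/\ q.1 <= q'.1, q'.1 + sz s k.+1 <= q.1 + sz s k,
        q.2 <= q'.2 & q'.2 + sz u k.+1 <= q.2 + sz u k].
  have hs : sz s k = sz s k.+1 + sz s k.+1 by rewrite -sz2; lra.
  have hu : sz u k = sz u k.+1 + sz u k.+1 by rewrite -sz2; lra.
  have ps := sz0 _ k.+1 s0; have pu := sz0 _ k.+1 u0.
  have [g1|] := pselect (good k.+1 (q.1, q.2));
    last by exists (q.1, q.2); split => //; split => /=; lra.
  have [g2|] := pselect (good k.+1 (q.1 + sz s k.+1, q.2));
    last by exists (q.1 + sz s k.+1, q.2); split => //; split => /=; lra.
  have [g3|] := pselect (good k.+1 (q.1, q.2 + sz u k.+1));
    last by exists (q.1, q.2 + sz u k.+1); split => //; split => /=; lra.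
  have [g4|] := pselect (good k.+1 (q.1 + sz s k.+1, q.2 + sz u k.+1));
    last by exists (q.1 + sz s k.+1, q.2 + sz u k.+1); split => //; split => /=; lra.
  (* If all four quarters are good then so is [q], and the implication is vacuous. The successor in
     the threshold accounts for level [p.+1] on [q] being level [p] on its quarters. *)
  exists q; split; last by split; lra.
  case; case: g1 g2 g3 g4 => n1 _ g1 [n2 _ g2] [n3 _ g3] [n4 _ g4].
  exists (n1 + n2 + n3 + n4).+1 => // -[//|p] /= np.
  rewrite contourS !sz2.
  have -> : e / 4 ^+ k = e / 4 ^+ k.+1 + e / 4 ^+ k.+1 + e / 4 ^+ k.+1 + e / 4 ^+ k.+1.
    by rewrite exprS; field; rewrite expf_neq0.
  have [le1 le2 le3 le4] : [/\ (n1 <= p)%N, (n2 <= p)%N, (n3 <= p)%N & (n4 <= p)%N].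
    by split; lia.
  by apply: ler_nrmD (g4 _ le4); apply: ler_nrmD (g3 _ le3);
     apply: ler_nrmD (g2 _ le2); exact: g1.
have [F HF] := choice (fun kq : nat * (R * R) => step kq.1 kq.2).
pose Q := fix Q k : R * R := if k is k'.+1 then F (k', Q k') else (x, y).
have badQ k : ~ good k (Q k).
  by elim: k => [//|k IH]; have [+ _] := HF (k, Q k); apply.
have [lx Hx] : exists l, forall k, (Q k).1 <= l <= (Q k).1 + sz s k.
  apply: nested_intervals; first exact: ltW.
  by move=> k; have [_ []] := HF (k, Q k).
have [ly Hy] : exists l, forall k, (Q k).2 <= l <= (Q k).2 + sz u k.
  apply: nested_intervals; first exact: ltW.
  by move=> k; have [_ []] := HF (k, Q k).
have dl : differentiable h (Complex lx ly).
  by apply: dh; [have := Hx 0%N | have := Hy 0%N]; rewrite /sz/= expr0 divr1.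
have [d hd] := differentiable_affine _ _ _ dl.
have su0 : 0 < s + u by rewrite addr_gt0.
(* At stage [k] the perimeter is 2 (s + u) / 2^k and points are at distance at most (s + u) / 2^k
   from the limit point; the product with this slope is exactly e / 4^k. *)
have /hd/nbhs_nrm[r r0 rd] : 0 < e / (2 * (s + u) ^+ 2).
  by rewrite divr_gt0// mulr_gt0// exprn_gt0.
have [k kr] : exists k, sz (s + u) k < r.
  have h01 : 0 <= (2^-1 : R) < 1 by lra.
  have [k kr] := filter_ex (near_geometric_lt (s + u) _ _ h01 r0).
  by exists k; rewrite /sz -exprVn.
apply: (badQ k); apply: nearW => p.
rewrite (contour_remainder p h (h (Complex lx ly)) d (Complex lx ly)).
have -> : e / 4 ^+ k = 2 * (sz s k + sz u k) * (e / (2 * (s + u) ^+ 2) * sz (s + u) k).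
  have -> : 4 ^+ k = 2 ^+ k * 2 ^+ k :> R.
    by rewrite -exprMn; congr (_ ^+ _); rewrite -natrM.
  by rewrite /sz; field; rewrite expf_neq0//= gt_eqF.
apply: nrm_contour_le => [||x' y' x'I y'I]; [exact/ltW/sz0|exact/ltW/sz0|].
have wz : nrm (Complex x' y' - Complex lx ly) <= sz (s + u) k.
  have -> : Complex x' y' - Complex lx ly = Complex (x' - lx) (y' - ly) by [].
  apply: le_trans (nrm_complex_le _ _) _.
  have -> : sz (s + u) k = sz s k + sz u k by rewrite /sz mulrDl.
  by apply: lerD; rewrite ler_norml; [move: (Hx k)|move: (Hy k)]; lra.
rewrite opprD addrA; apply: le_trans (rd _ (le_lt_trans wz kr)) _.
by apply: ler_wpM2l => //; apply: divr_ge0; rewrite ?mulr_ge0 ?exprn_ge0// ltW.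
Qed.

End Goursat.
Arguments contour {R X}.

(** * Mean value property and the maximum principle on the strip *)

Section CircleAverage.
Context {R : realType} (X : normedModType R[i]).
Implicit Types g q : R[i] -> X.

Definition cavg p q (r : R) : X :=
  davg p (fun t => q ((r%:C)%C * cis t)) 0 (2 * pi).

Lemma nrm_circle (r t : R) : 0 <= r -> nrm ((r%:C)%C * cis t) = r.
Proof. by move=> r0; rewrite nrmM nrmR nrm_cis mulr1 ger0_norm. Qed.

Lemma nrm_cavg_le p q r c : 0 <= r ->
  (forall z, nrm z = r -> nrm (q z) <= c) -> nrm (cavg p q r) <= c.
Proof.
move=> r0 qc; apply: nrm_davg_le; first by rewrite mulr_ge0// pi_ge0.
by move=> t _; apply: qc; rewrite nrm_circle.
Qed.

(* In the coordinate [w = log z] an annulus becomes a rectangle whose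
   horizontal sides carry the same values by periodicity. *)
Lemma cavg_annulus q (r1 r2 : R) : 0 < r1 -> r1 < r2 ->
  (forall z, r1 <= nrm z <= r2 -> differentiable q z) ->
  forall e : R, 0 < e -> \forall p \near \oo, nrm (cavg p q r2 - cavg p q r1) <= e.
Proof.
move=> r10 r12 dq e e0.
have r20 : 0 < r2 by exact: lt_trans r12.
have pi0 : 0 < 2 * pi :> R by rewrite mulr_gt0// pi_gt0.
have l12 : 0 < ln r2 - ln r1 by rewrite subr_gt0 ltr_ln.
pose h w := q (cexp w).
have dh x' y' : ln r1 <= x' <= ln r1 + (ln r2 - ln r1) -> 0 <= y' <= 0 + 2 * pi ->
    differentiable h (Complex x' y').
  move=> /andP[x1 x2] _; apply: differentiable_comp; first exact: differentiable_cexp.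
  apply: dq; rewrite nrm_cexp /=; apply/andP; split.
    by rewrite -[leLHS]lnK ?posrE// ler_expR.
  by rewrite -[leRHS]lnK ?posrE// ler_expR; lra.
have /(goursat _ _ _ _ _ _ l12 pi0 dh) : 0 < 2 * pi * e by rewrite mulr_gt0.
apply: filterS => p; rewrite /contour.
have hE r t : 0 < r -> h (Complex (ln r) t) = q ((r%:C)%C * cis t).
  by move=> r0; rewrite /h /cexp /= lnK ?posrE.
rewrite (eq_davg _ _ _ (fun t => h (Complex t (0 + 2 * pi))) (fun t => h (Complex t 0))).
  rewrite subrr scaler0 add0r subrKC nrmZ nrmI gtr0_norm// ler_pM2l//.
  rewrite (eq_davg _ _ _ (fun t => h (Complex (ln r2) t)) (fun t => q ((r2%:C)%C * cis t))).
    rewrite (eq_davg _ _ _ (fun t => h (Complex (ln r1) t)) (fun t => q ((r1%:C)%C * cis t)))//.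
    by move=> t; rewrite hE.
  by move=> t; rewrite hE.
by move=> t; rewrite add0r /h /cexp /= cis2pi cis0.
Qed.

Lemma cavg_near0 g : (forall e : R, 0 < e -> \forall z \near 0, nrm (g z - g 0) < e) ->
  forall e : R, 0 < e -> exists2 d : R, 0 < d &
    forall r p, 0 <= r < d -> nrm (cavg p g r - g 0) <= e.
Proof.
move=> g0 e /g0/nbhs_nrm[d d0 gd]; exists d => // r p /andP[r0 rd].
have -> : g 0 = davg p (fun _ : R => g 0) 0 (2 * pi) by rewrite davg_cst.
rewrite -davgB.
apply: nrm_davg_le; first by rewrite mulr_ge0// pi_ge0.
by move=> t _; apply/ltW/gd; rewrite subr0 nrm_circle.
Qed.

(** The annulus lemma compares the circle with a small one, where continuity at 0 concludes. *)
Lemma mean_value g (r : R) : 0 < r ->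
  (forall z, nrm z <= r -> differentiable g z) ->
  forall e : R, 0 < e -> \forall p \near \oo, nrm (cavg p g r - g 0) <= e.
Proof.
move=> r0 dg e e0; have e2 : 0 < e / 2 by rewrite divr_gt0.
have g0 : differentiable g 0 by apply: dg; rewrite nrm0 ltW.
have [d d0 gd] := cavg_near0 _ (differentiable_nrm_near _ _ _ g0) _ e2.
pose r' := Num.min d r / 2.
have m0 : 0 < Num.min d r by rewrite lt_min d0.
have [md mr] : Num.min d r <= d /\ Num.min d r <= r by rewrite !ge_min !lexx orbT.
have r'0 : 0 < r' by rewrite /r'; lra.
have r'r : r' < r by rewrite /r'; lra.
have dg' z : r' <= nrm z <= r -> differentiable g z by move=> /andP[_ /dg].
apply: filterS (cavg_annulus g r' r r'0 r'r dg' _ e2) => p h1.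
have h2 : nrm (cavg p g r' - g 0) <= e / 2 by apply: gd; rewrite /r'; lra.
by have := nrm_tri _ (cavg p g r') (cavg p g r) (g 0); lra.
Qed.

End CircleAverage.
Arguments cavg {R X}.

Section StripMaximum.
Context {R : realType} (X : normedModType R[i]).

Lemma within_continuous_nrm (A : set R[i]) (f : R[i] -> X) :
  {within A, continuous f} -> forall z, A z -> forall e : R, 0 < e ->
  exists2 d : R, 0 < d & forall w, A w -> nrm (w - z) < d -> nrm (f w - f z) < e.
Proof.
move=> /subspace_continuousP fA z /fA fz e e0.
have := (cvg_nrm _ _ (within A (nbhs z)) f (f z)).1 fz e e0.
rewrite near_withinE => /(_ (within_filter _ _)) h.
have [d d0 dP] := (nbhs_nrm _ z (fun w => A w -> nrm (f w - f z) < e)).1 h.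
by exists d => // w Aw wd; exact: dP.
Qed.

(** The function 2 x^2 - y^2 has Laplacian 2, so its circle average exceeds the central value by r^2
    / 2; it also tends to minus infinity along the strip. Two bisections make the discrete average
    exact: one cancels cos and sin, the second cancels cos^2 - sin^2, whose period is pi. *)
Lemma davg_quadratic p (x y r : R) :
  davg p.+2 (V := R^o) (fun t => 2 * (x + r * cos t) ^+ 2 - (y + r * sin t) ^+ 2)
    0 (2 * pi) = 2 * x ^+ 2 - y ^+ 2 + r ^+ 2 / 2.
Proof.
have pi2 : 2 * pi / 2 = pi :> R by rewrite mulrAC divff// mul1r.
have ac : davg p.+2 (V := R^o) (@cos R) 0 (2 * pi) = 0.
  by apply: (davg_antiperiodic R R^o) => t; rewrite pi2 cosDpi.
have as' : davg p.+2 (V := R^o) (@sin R) 0 (2 * pi) = 0.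
  by apply: (davg_antiperiodic R R^o) => t; rewrite pi2 sinDpi.
have a2 : davg p.+2 (V := R^o) (fun t : R => cos t ^+ 2 - sin t ^+ 2) 0 (2 * pi) = 0.
  rewrite (davg_periodic R R^o); last by move=> t; rewrite pi2 cosDpi sinDpi !sqrrN.
  apply: (davg_antiperiodic R R^o) => t; rewrite pi2 cosDpihalf sinDpihalf.
  by rewrite sqrrN opprB.
have lin (k0 k1 k2 k3 : R) (f1 f2 f3 : R -> R^o) :
    davg p.+2 (V := R^o) (fun t => k0 + k1 *: f1 t + k2 *: f2 t + k3 *: f3 t) 0 (2 * pi) =
    k0 + k1 * davg p.+2 f1 0 (2 * pi) + k2 * davg p.+2 f2 0 (2 * pi)
    + k3 * davg p.+2 f3 0 (2 * pi).
  rewrite (davgD R R^o _ (fun t => k0 + k1 *: f1 t + k2 *: f2 t) (fun t => k3 *: f3 t)).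
  rewrite (davgD R R^o _ (fun t => k0 + k1 *: f1 t) (fun t => k2 *: f2 t)).
  rewrite (davgD R R^o _ (fun t => k0) (fun t => k1 *: f1 t)).
  by rewrite !(davgZ R R^o) (davg_cst R R^o).
rewrite (eq_davg R R^o _ _ (fun t => (2 * x ^+ 2 - y ^+ 2 + r ^+ 2 / 2) +
   (4 * x * r) *: (cos t : R^o) + (- (2 * y * r)) *: (sin t : R^o) +
   (3 / 2 * r ^+ 2) *: (cos t ^+ 2 - sin t ^+ 2 : R^o))).
  by rewrite lin ac as' a2 !mulr0 !addr0.
move=> t /=; rewrite -![_ *: _]/(_ * _).
have -> : r ^+ 2 / 2 = r ^+ 2 / 2 * (cos t ^+ 2 + sin t ^+ 2).
  by rewrite cos2Dsin2 mulr1.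
by field.
Qed.

(** Adding eta (2 x^2 - y^2) to the norm of [f] makes it strictly subharmonic and forces it down at
    both ends of the strip. Its maximum over a compact rectangle then lies on one of the two
    vertical lines, and eta tends to 0. *)
Lemma strip_maximum (f : R[i] -> X) (M c : R) :
  (forall z, strip z -> nrm (f z) <= M) ->
  {within strip (R := R), continuous f} ->
  (forall z, ostrip z -> differentiable f z) ->
  (forall t, nrm (f (Complex 0 t)) <= c) ->
  (forall t, nrm (f (Complex 1 t)) <= c) ->
  forall z, strip z -> nrm (f z) <= c.
Proof.
move=> fM fcont fdiff f0 f1 z0 z0S.
have M0 : 0 <= M by apply: le_trans (nrm_ge0 _ _) (fM _ z0S).
case: z0 z0S => a b; rewrite /strip/= => abS.
suff main eta : 0 < eta -> nrm (f (Complex a b)) <= c + eta * (2 + b ^+ 2).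
  apply/ler_addgt0Pr => e e0; have b2 : 0 < 2 + b ^+ 2 by rewrite ltr_pwDl// sqr_ge0.
  have /main : 0 < e / (2 + b ^+ 2) by rewrite divr_gt0.
  by rewrite divfK// gt_eqF.
move=> eta0; pose phi (q : R * R) : R := 2 * q.1 ^+ 2 - q.2 ^+ 2.
pose U (q : R * R) : R := nrm (f (Complex q.1 q.2)) + eta * phi q.
have [Q Q0 QE] : exists2 Q : R, 0 <= Q & Q * eta = M + 2 * eta.
  exists ((M + 2 * eta) / eta); first by rewrite divr_ge0//; lra.
  by rewrite divfK// gt_eqF.
(* So large that [U] is negative on the horizontal sides, whereas [U (0, 0)] is nonnegative, and
   that [(a, b)] lies in the rectangle. *)
pose T := 1 + `|b| + Q.
have T1 : 1 <= T by rewrite /T; move: (normr_ge0 b); lra.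
have bT : `|b| < T by rewrite /T; lra.
have TM : M + 2 * eta < eta * T ^+ 2.
  rewrite -QE mulrC ltr_pM2l//; apply: (@lt_le_trans _ _ T).
    by rewrite /T; move: (normr_ge0 b); lra.
  by rewrite expr2 ler_peMl//; lra.
pose K : set (R * R) := `[0, 1] `*` `[- T, T].
have KE q : K q <-> 0 <= q.1 <= 1 /\ - T <= q.2 <= T.
  by rewrite /K/= !in_itv/=.
have Ucont : {within K, continuous U}.
  apply/subspace_continuousP => -[x y] /KE/= [xI yI].
  apply: cvgD; last first.
    apply: cvg_within_filter; apply: cvgMr; apply: cvgB.
      by apply: cvgMr; apply: cvgM; exact: cvg_fst.
    by apply: cvgM; exact: cvg_snd.
  apply/cvgrPdist_lt => e e0.
  have xyS : strip (Complex x y) by [].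
  have [d d0 dP] := within_continuous_nrm _ _ fcont _ xyS _ e0.
  have d2 : 0 < d / 2 by rewrite divr_gt0.
  apply/nbhs_ballP; exists (d / 2) => // -[x' y'] [/= xx yy] /KE/= [x'I y'I].
  have : nrm (f (Complex x' y') - f (Complex x y)) < e.
    apply: dP => //.
    have -> : Complex x' y' - Complex x y = Complex (x' - x) (y' - y) by [].
    apply: le_lt_trans (nrm_complex_le _ _) _.
    by move: xx yy; rewrite /ball/= distrC [`|y - _|]distrC; lra.
  rewrite ltr_norml; move: (nrm_sub_le _ (f (Complex x' y')) (f (Complex x y))).
  move: (nrm_sub_le _ (f (Complex x y)) (f (Complex x' y'))).
  rewrite (nrmBC _ (f (Complex x y)) (f (Complex x' y'))); lra.
have Kcpt : compact K by apply: compact_setX; exact: segment_compact.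
have K0 : K (0, 0) by apply/KE => /=; lra.
have [[x y] xyK Umax] := compact_EVT_max (ex_intro _ _ K0) Kcpt Ucont.
have {}Umax q : K q -> U q <= U (x, y) by move=> Kq; apply: Umax; rewrite inE.
move: xyK; rewrite inE => /KE/= [xI yI].
have yT : - T < y < T.
  have : eta * y ^+ 2 < eta * T ^+ 2.
    have := Umax _ K0; rewrite /U /phi /= !expr0n/= mulr0 subr0 mulr0 addr0.
    have := nrm_ge0 _ (f (Complex 0 0)); have := fM (Complex x y) xI.
    have : eta * x ^+ 2 <= eta by rewrite -[leRHS]mulr1 ler_pM2l//; nra.
    by move: TM; rewrite mulrBr [eta * (2 * _)]mulrCA; lra.
  rewrite ltr_pM2l// => y2T2; rewrite -ltr_norml.
  by rewrite -(@ltr_pXn2r _ 2)// ?nnegrE ?real_normK ?num_real//; lra.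
have Uc : U (x, y) <= c + 2 * eta.
  have [/eqP x0|x0] := boolP (x == 0).
    have := f0 y; rewrite /U /phi/= x0 expr0n/= mulr0 sub0r.
    by have := sqr_ge0 y; nra.
  have [/eqP x1|x1] := boolP (x == 1).
    have := f1 y; rewrite /U /phi/= x1 expr1n mulr1.
    by have := sqr_ge0 y; nra.
  exfalso.
  have [xp xl] : 0 < x /\ x < 1 by split; lra.
  have [r [r0 rx rx1 ryT ryT']] : exists r : R, [/\ 0 < r, r < x, r < 1 - x, r < T - y & r < T + y].
    pose m := Num.min (Num.min x (1 - x)) (Num.min (T - y) (T + y)).
    have m0 : 0 < m by rewrite !lt_min; lra.
    have : m <= m by []; rewrite {2}/m !le_min => /andP[/andP[m1 m2] /andP[m3 m4]].
    by exists (m / 2); split; lra.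
  pose g (w : R[i]) := f (Complex x y + w).
  have dg w : nrm w <= r -> differentiable g w.
    move=> wr; apply: (@differentiable_comp _ _ _ _ (fun w => Complex x y + w) f).
      by apply: differentiableD; [exact: differentiable_cst|exact: ex_diff].
    apply: fdiff; case: w wr => w1 w2 wr; have := ler_Re_nrm (Complex w1 w2).
    by rewrite /ostrip /= ler_norml; lra.
  (* At an interior maximum the average would fall short of the central norm by eta r^2 / 2; half of
     this as error in the mean value property already gives the contradiction. The level [p0.+2] is
     one at which [davg_quadratic] applies. *)
  have e0 : 0 < eta * r ^+ 2 / 4 by rewrite divr_gt0// mulr_gt0// exprn_gt0.
  have [p0 _ /(_ p0.+2)/(_ (ltnW (ltnW (leqnn _))))/=] := mean_value _ g r r0 dg _ e0.
  have : nrm (cavg p0.+2 g r) <= nrm (f (Complex x y)) - eta * r ^+ 2 / 2.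
    apply: le_trans (nrm_davg _ _ _ _ _) _.
    have -> : nrm (f (Complex x y)) - eta * r ^+ 2 / 2 =
      davg p0.+2 (V := R^o) (fun t => U (x, y) -
        eta * (2 * (x + r * cos t) ^+ 2 - (y + r * sin t) ^+ 2)) 0 (2 * pi).
      rewrite (davgB R R^o) (davg_cst R R^o).
      rewrite (davgZ R R^o _ eta) davg_quadratic -[_ *: _]/(_ * _) /U /phi /=; ring.
    apply: davg_le; first by rewrite mulr_ge0// pi_ge0.
    move=> t _; have := nrm_circle r t (ltW r0); set w := _ * cis t => wr.
    have wE : Complex x y + w = Complex (x + r * cos t) (y + r * sin t).
      by apply/eqP; rewrite eq_complex /=; apply/andP; split; apply/eqP; ring.
    have := Umax (x + r * cos t, y + r * sin t).
    rewrite {1}/U /phi /g wE /= lerBrDr; apply; apply/KE => /=.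
    have := ler_Re_nrm w; have := ler_Im_nrm w; rewrite wr /w /= !ler_norml.
    by rewrite !mul0r subr0 addr0; lra.
  rewrite {3}/g addr0 => h1 h2.
  have := nrm_sub_le _ (f (Complex x y)) (cavg p0.+2 g r); rewrite nrmBC.
  by move: e0 h1 h2; lra.
have := Umax (a, b); rewrite {1}/U /phi/=.
have Kab : K (a, b) by apply/KE => /=; move: bT; rewrite ltr_norml; lra.
by move=> /(_ Kab); have := sqr_ge0 a; nra.
Qed.

End StripMaximum.

(** * Cauchy's formula *)

Section ComplexRational.
Context {R : realType}.
Implicit Types f g : R[i] -> R[i].

Lemma differentiable_mulc f g (z : R[i]) : differentiable f z ->
  differentiable g z -> differentiable (fun w => f w * g w) z.
Proof. exact: (differentiable_scaler R[i]). Qed.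

Lemma differentiable_idc (z : R[i]) : differentiable (fun w : R[i] => w) z.
Proof. exact: ex_diff. Qed.

Lemma differentiable_subc (a z : R[i]) : differentiable (fun w : R[i] => w - a) z.
Proof.
by apply: differentiableB; [exact: differentiable_idc|exact: differentiable_cst].
Qed.

Lemma differentiable_invc (a z : R[i]) : z != a ->
  differentiable (fun w : R[i] => (w - a)^-1) z.
Proof.
move=> za; apply: (@differentiable_comp _ _ _ _ (fun w : R[i] => w - a) (fun w => w^-1)).
  exact: differentiable_subc.
by apply: (differentiable_Rinv (R := R[i])); rewrite subr_eq0.
Qed.

End ComplexRational.

Section CircleContinuity.
Context {R : realType} (X : normedModType R[i]).
Implicit Types q : R[i] -> X.

Definition nrm_continuous_at q (z : R[i]) :=
  forall e : R, 0 < e -> \forall w \near z, nrm (q w - q z) < e.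

Lemma cis_lt_near0 (e : R) : 0 < e ->
  exists2 d : R, 0 < d & forall s t, `|t - s| < d -> nrm (cis t - cis s) < e.
Proof.
move=> e0; have e2 : 0 < e / 2 by rewrite divr_gt0.
have /cvgrPdist_lt/(_ _ e2)/nbhs_ballP[d1 /= d10 h1] := @continuous_cos R 0.
have /cvgrPdist_lt/(_ _ e2)/nbhs_ballP[d2 /= d20 h2] := @continuous_sin R 0.
exists (Num.min d1 d2); first by rewrite lt_min d10.
move=> s t; rewrite lt_min => /andP[t1 t2].
have -> : cis t - cis s = cis s * (cis (t - s) - cis 0).
  by rewrite mulrBr -!cisD subrKC addr0.
rewrite nrmM nrm_cis mul1r.
have -> : cis (t - s) - cis 0 = Complex (cos (t - s) - cos 0) (sin (t - s) - sin 0) by [].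
apply: le_lt_trans (nrm_complex_le _ _) _.
have := h1 (t - s); have := h2 (t - s).
by rewrite /ball/= sub0r normrN (distrC (cos 0)) (distrC (sin 0)) => /(_ t2) + /(_ t1); lra.
Qed.

(** The point [w] ranges over a neighbourhood of the circle in the plane, so the same modulus serves
    both for refining the grid and for changing the radius. *)
Lemma circle_uniform_continuity q (r : R) : 0 <= r ->
  (forall z, nrm z = r -> nrm_continuous_at q z) ->
  forall e : R, 0 < e -> exists2 d : R, 0 < d &
    forall t, 0 <= t <= 2 * pi -> forall w, nrm (w - (r%:C)%C * cis t) < d ->
      nrm (q w - q ((r%:C)%C * cis t)) < e.
Proof.
move=> r0 qc e e0; have e2 : 0 < e / 2 by rewrite divr_gt0.
pose P (d t : R) := forall w, nrm (w - (r%:C)%C * cis t) < d ->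
      nrm (q w - q ((r%:C)%C * cis t)) < e.
have : \forall d \near (0 : R)^'+, `[0, 2 * pi] `<=` P d.
  apply: (compact_near_coveringP _).1; first exact: segment_compact.
  move=> t0 _; have := qc _ (nrm_circle r t0 r0) _ e2 => /nbhs_nrm[d d0 dP].
  have d2 : 0 < d / 2 by rewrite divr_gt0.
  have [d' d'0 d'P] := cis_lt_near0 (d / 2 / (r + 1)) (ltac:(rewrite divr_gt0//; lra)).
  exists (ball t0 d', [set x | x < d / 2]).
    split; first exact: nbhsx_ballx.
    by near=> x; near: x; exact: nbhs_right_lt.
  move=> [t x] [/= tt0 xd] w wx.
  have ct : nrm ((r%:C)%C * cis t - (r%:C)%C * cis t0) < d / 2.
    rewrite -mulrBr nrmM nrmR ger0_norm//.
    apply: (@le_lt_trans _ _ ((r + 1) * nrm (cis t - cis t0))).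
      by apply: ler_wpM2r; [exact: nrm_ge0|lra].
    rewrite -ltr_pdivlMl; last lra.
    by rewrite mulrC; apply: d'P; rewrite distrC.
  have h1 : nrm (q w - q ((r%:C)%C * cis t0)) < e / 2.
    by apply: dP; have := nrm_tri _ ((r%:C)%C * cis t) w ((r%:C)%C * cis t0); lra.
  have h2 : nrm (q ((r%:C)%C * cis t) - q ((r%:C)%C * cis t0)) < e / 2.
    by apply: dP; lra.
  have := nrm_tri _ (q ((r%:C)%C * cis t0)) (q w) (q ((r%:C)%C * cis t)).
  by rewrite (nrmBC _ (q (_ * cis t0)) (q (_ * cis t))); lra.
move=> h; have [d [/= d0 dP]] := filter_ex (filterI (nbhs_right_gt 0) h).
by exists d => // t tI; apply: dP; rewrite /= in_itv.
Unshelve. all: by end_near. Qed.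

Lemma nrm_davg_refine (h : R -> X) (e : R) k p a s : 0 <= s ->
  (forall t t', a <= t <= a + s -> a <= t' <= a + s -> `|t' - t| <= s / 2 ^+ p ->
     nrm (h t' - h t) <= e) ->
  nrm (davg (k + p) h a s - davg p h a s) <= e.
Proof.
elim: p a s => [|p IH] a s s0 hh.
  rewrite addn0 /= -[X in _ - X](@davg_cst R _ _ k (h a) a s) -davgB.
  apply: nrm_davg_le => // t tI; apply: hh => //; first by lra.
  by rewrite expr0 divr1 ler_norml; lra.
rewrite addnS /= -scalerBr opprD addrACA nrmZ nrmV.
rewrite -[2]/(2%:R) -(rmorph_nat (real_complex R)) nrmR normr_nat ler_pdivrMl//.
rewrite [leRHS]mulr_natl [leRHS]mulr2n.
have E : s / 2 / 2 ^+ p = s / 2 ^+ p.+1 by rewrite exprS invfM mulrA.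
apply: ler_nrmD; apply: IH; (try lra) => t t' tI t'I tt'; apply: hh; (try lra);
  by rewrite -E.
Qed.

Lemma cavg_cauchy q (r : R) : 0 <= r ->
  (forall z, nrm z = r -> nrm_continuous_at q z) ->
  forall e : R, 0 < e -> exists N, forall m n, (N <= m)%N -> (N <= n)%N ->
    nrm (cavg m q r - cavg n q r) < e.
Proof.
move=> r0 qc e e0; have e3 : 0 < e / 3 by rewrite divr_gt0.
have [d d0 dP] := circle_uniform_continuity _ _ r0 qc _ e3.
have [d' d'0 d'P] := cis_lt_near0 (d / (r + 1)) (ltac:(rewrite divr_gt0//; lra)).
have pi0 : 0 < 2 * pi :> R by rewrite mulr_gt0// pi_gt0.
have [N NP] : exists N, 2 * pi / 2 ^+ N < d'.
  have h01 : 0 <= (2^-1 : R) < 1 by lra.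
  have [N NP] := filter_ex (near_geometric_lt (2 * pi) _ _ h01 d'0).
  by exists N; rewrite -exprVn.
have key m : (N <= m)%N -> nrm (cavg m q r - cavg N q r) <= e / 3.
  move=> Nm; rewrite -(subnK Nm); apply: nrm_davg_refine; first exact: ltW.
  rewrite add0r => t t' tI t'I tt'; apply/ltW/dP => //.
  rewrite -mulrBr nrmM nrmR ger0_norm//.
  apply: (@le_lt_trans _ _ ((r + 1) * nrm (cis t' - cis t))).
    by apply: ler_wpM2r; [exact: nrm_ge0|lra].
  rewrite -ltr_pdivlMl; last lra.
  by rewrite mulrC; apply: d'P; exact: le_lt_trans NP.
exists N => m n /key hm /key hn.
have := nrm_tri _ (cavg N q r) (cavg m q r) (cavg n q r).
by rewrite (nrmBC _ (cavg N q r)); lra.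
Qed.

Lemma cavg_radius_continuous q (r : R) : 0 <= r ->
  (forall z, nrm z = r -> nrm_continuous_at q z) ->
  forall e : R, 0 < e -> exists2 d : R, 0 < d &
    forall r' p, `|r' - r| < d -> nrm (cavg p q r' - cavg p q r) <= e.
Proof.
move=> r0 qc e e0.
have [d d0 dP] := circle_uniform_continuity _ _ r0 qc _ e0.
exists d => // r' p r'd; rewrite -davgB; apply: nrm_davg_le.
  by rewrite mulr_ge0// pi_ge0.
rewrite add0r => t tI; apply/ltW/dP => //.
by rewrite -mulrBl -rmorphB/= nrmM nrmR nrm_cis mulr1.
Qed.

(* The circle [nrm z = a], on which [q] is only assumed continuous, is crossed
   by continuity of the averages in the radius. *)
Lemma cavg_limit q (a r : R) : 0 < a -> a < r -> nrm_continuous_at q 0 ->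
  (forall z, nrm z = a -> nrm_continuous_at q z) ->
  (forall z, 0 < nrm z <= r -> nrm z != a -> differentiable q z) ->
  forall e : R, 0 < e -> \forall p \near \oo, nrm (cavg p q r - q 0) <= e.
Proof.
move=> a0 ar q0 qa dq e e0; have e5 : 0 < e / 5 by rewrite divr_gt0.
have [d1 d10 h1] := cavg_near0 _ _ q0 _ e5.
have [d2 d20 h2] := cavg_radius_continuous _ _ (ltW a0) qa _ e5.
(* The comparison runs through the radii [r], [a + b / 2], [a], [r1], [r0] and ends at the value
   [q 0]: five gaps of [e / 5]. *)
have [b [b0 b1 ba b2 br]] : exists b : R, [/\ 0 < b, b < d1, b < a, b < d2 & b < r - a].
  pose m := Num.min (Num.min d1 a) (Num.min d2 (r - a)).
  have m0 : 0 < m by rewrite !lt_min d10 a0 d20 subr_gt0.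
  have : m <= m by []; rewrite {2}/m !le_min => /andP[/andP[m1 m2] /andP[m3 m4]].
  by exists (m / 2); split; lra.
have [r1 [r1a r1b r10]] : exists r1 : R, [/\ r1 < a, a - b < r1 & 0 < r1].
  by exists (a - b / 2); split; lra.
pose r0 := Num.min b r1 / 2.
have m0 : 0 < Num.min b r1 by rewrite lt_min b0.
have [mb mr] : Num.min b r1 <= b /\ Num.min b r1 <= r1 by rewrite !ge_min !lexx orbT.
have r00 : 0 < r0 by rewrite /r0; lra.
have r0r1 : r0 < r1 by rewrite /r0; lra.
have in1 z : r0 <= nrm z <= r1 -> differentiable q z.
  by move=> zI; apply: dq; [lra|rewrite lt_eqF//; lra].
have in2 z : a + b / 2 <= nrm z <= r -> differentiable q z.
  by move=> zI; apply: dq; [lra|rewrite gt_eqF//; lra].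
have a2r : a + b / 2 < r by lra.
have a20 : 0 < a + b / 2 by lra.
have A1 := cavg_annulus _ q r0 r1 r00 r0r1 in1 _ e5.
have A2 := cavg_annulus _ q (a + b / 2) r a20 a2r in2 _ e5.
apply: filterS (filterI A1 A2) => p [{}A1 {}A2].
have B0 : nrm (cavg p q r0 - q 0) <= e / 5 by apply: h1; rewrite /r0; lra.
have B1 : nrm (cavg p q r1 - cavg p q a) <= e / 5.
  by apply: h2; rewrite ltr_norml; lra.
have B2 : nrm (cavg p q (a + b / 2) - cavg p q a) <= e / 5.
  by apply: h2; rewrite ltr_norml; lra.
have := nrm_tri _ (cavg p q (a + b / 2)) (cavg p q r) (q 0).
have := nrm_tri _ (cavg p q a) (cavg p q (a + b / 2)) (q 0).
have := nrm_tri _ (cavg p q r1) (cavg p q a) (q 0).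
have := nrm_tri _ (cavg p q r0) (cavg p q r1) (q 0).
by rewrite (nrmBC _ (cavg p q a) (cavg p q r1)); lra.
Qed.

(** Since dz = i z dt on a circle, the factor [z] turns the contour integral of (g z - g a) / (z -
    a) into an average. The integrand vanishes at 0 and has a removable singularity at [a], so
    [cavg_limit] applies with the critical circle through [a]. *)
Lemma cauchy_formula (g : R[i] -> X) (a : R[i]) (r : R) : nrm a < r ->
  (forall z, nrm z <= r -> differentiable g z) ->
  forall e : R, 0 < e -> \forall p \near \oo,
    nrm (cavg p (fun z => (z / (z - a)) *: (g z - g a)) r) <= e.
Proof.
move=> ar dg e e0.
have ra z : nrm z = r -> z != a by move=> zr; apply: contraTneq ar => <-; rewrite zr ltxx.
have r0 : 0 < r by apply: le_lt_trans ar; exact: nrm_ge0.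
(* For [a = 0] the critical circle degenerates, but the factor is 1 off the centre and the mean
   value property suffices. *)
have [a0|a0] := eqVneq a 0.
  have := mean_value _ (fun z => g z - g a) r r0 _ _ e0.
  rewrite a0 subrr => h; have {}h := h _.
  apply: filterS (h _) => [p|z zr]; last first.
    by apply: differentiableB; [exact: dg|exact: differentiable_cst].
  rewrite subr0; congr (nrm _ <= _); apply: eq_davg => t.
  rewrite subr0 divff ?scale1r//; apply: nrm_neq0.
  by rewrite nrm_circle// ltW.
have an0 : 0 < nrm a.
  by apply: nrm_gt0.
have [d hd] := differentiable_affine _ _ _ (dg _ (ltW ar)).
(* The value at [a] is the limit a g'(a), which makes [q] continuous there. *)
pose q (z : R[i]) : X := if z == a then a *: d else (z / (z - a)) *: (g z - g a).
have q00 : q 0 = 0 by rewrite /q eq_sym (negbTE a0) mul0r scale0r.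
have dq z : nrm z <= r -> z != a -> differentiable q z.
  move=> zr za; have za0 : z - a != 0 by rewrite subr_eq0.
  have : differentiable (fun w : R[i] => (w / (w - a)) *: (g w - g a)) z.
    apply: differentiable_scaler.
      by apply: differentiable_mulc; [exact: differentiable_idc|exact: differentiable_invc].
    by apply: differentiableB; [exact: dg|exact: differentiable_cst].
  apply: near_eq_differentiable; apply/nbhs_nrm.
  exists (nrm (z - a)) => [|w wz]; first exact: nrm_gt0.
  have wa : w != a by apply: contraTneq wz => ->; rewrite nrmBC ltxx.
  by rewrite /q (negbTE wa).
have qa : nrm_continuous_at q a.
  move=> e' e'0; pose e1 := e' / (2 * (nrm a + 1)); pose e2 := e' / (2 * (nrm d + 1)).
  have d0 := nrm_ge0 _ d.
  have e10 : 0 < e1 by rewrite divr_gt0// mulr_gt0//; lra.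
  have e20 : 0 < e2 by rewrite divr_gt0// mulr_gt0//; lra.
  have [r1 r10 h1] := (nbhs_nrm _ _ _).1 (hd _ e10).
  apply/nbhs_nrm; exists (Num.min r1 (Num.min 1 e2)).
    by rewrite !lt_min r10 ltr01 e20.
  move=> w; rewrite lt_min => /andP[wr1]; rewrite lt_min => /andP[w1 we2].
  rewrite /q eqxx; have [_|wa] := eqVneq w a; first by rewrite subrr nrm0.
  have wa0 : w - a != 0 by rewrite subr_eq0.
  have wan : 0 < nrm (w - a).
    by apply: nrm_gt0.
  have -> : (w / (w - a)) *: (g w - g a) - a *: d =
    (w / (w - a)) *: (g w - g a - (w - a) *: d) + (w - a) *: d.
    move: (g w - g a) => P.
    by rewrite scalerBr scalerA divfK// scalerBl subrKA.
  have wn : nrm w <= nrm a + 1 by have := nrm_sub_le _ w a; lra.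
  have b1 : nrm ((w / (w - a)) *: (g w - g a - (w - a) *: d)) <= e' / 2.
    rewrite nrmZ nrmM nrmV.
    have -> : e' / 2 = (nrm a + 1) * e1 by rewrite /e1; field; lra.
    rewrite -mulrA; apply: ler_pM => //; first exact: nrm_ge0.
      by rewrite mulr_ge0 ?invr_ge0 ?nrm_ge0.
    by rewrite ler_pdivrMl// mulrC; exact: h1.
  have b2 : nrm ((w - a) *: d) < e' / 2.
    rewrite nrmZ; apply: (@le_lt_trans _ _ (nrm (w - a) * (nrm d + 1))).
      by apply: ler_wpM2l; [exact: nrm_ge0|lra].
    have -> : e' / 2 = e2 * (nrm d + 1) by rewrite /e2; field; lra.
    by rewrite ltr_pM2r//; lra.
  by have := nrmD _ ((w / (w - a)) *: (g w - g a - (w - a) *: d)) ((w - a) *: d); lra.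
have dn z : differentiable q z -> nrm_continuous_at q z by move=> h; exact: differentiable_nrm_near.
have q0 : nrm_continuous_at q 0 by apply/dn/dq; rewrite ?nrm0 ?ltW// eq_sym.
have qc z : nrm z = nrm a -> nrm_continuous_at q z.
  by move=> za; have [->//|] := eqVneq z a; move=> /dq h; apply/dn/h; rewrite za ltW.
have qd z : 0 < nrm z <= r -> nrm z != nrm a -> differentiable q z.
  by move=> /andP[_ zr] za; apply: dq => //; apply: contra_neq za => ->.
apply: filterS (cavg_limit q (nrm a) r an0 ar q0 qc qd _ e0) => p.
rewrite q00 subr0; congr (nrm _ <= _); apply: eq_davg => t.
by rewrite /q ifN// ra// nrm_circle// ltW.
Qed.

End CircleContinuity.

(** * Taylor expansion *)

Lemma expr_quotient (F : fieldType) (a c : F) m k :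
  (a * c)^-1 ^+ m * (a * c) ^+ k = (a^-1 ^+ m * a ^+ k) * (c ^+ k * c^-1 ^+ m).
Proof. by rewrite invfM !exprMn mulrACA [c^-1 ^+ m * _]mulrC. Qed.

(** * Discrete orthogonality of the powers of z on a circle *)

Section Orthogonality.
Context {R : realType}.

Lemma cisN (t : R) : cis (- t) = (cis t)^-1.
Proof.
have c0 : cis t != 0 by apply: nrm_neq0; rewrite nrm_cis.
by apply: (mulIf c0); rewrite -cisD addNr cis0 mulVf.
Qed.

(** The sign of the frequency is kept in [sg], so that divisibility stays in [nat]. An odd frequency
    cancels between the two halves of the grid; an even one is halved along with the grid. *)
Lemma davg_cis (sg : bool) p j :
  davg p (V := R[i]) (fun t : R => cis ((-1) ^+ sg * j%:R * t)) 0 (2 * pi) =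
  ((2 ^ p %| j)%N%:R).
Proof.
elim: p j => [|p IH] j; first by rewrite /= mulr0 cis0 expn0 dvd1n.
have pi2 : 2 * pi / 2 = pi :> R by rewrite mulrAC divff// mul1r.
have cj : cis ((-1) ^+ sg * j%:R * pi : R) = (-1) ^+ j.
  case: {IH}sg; rewrite ?expr0 ?mul1r ?mulN1r ?mulNr ?cisN -cisX cispi//.
  by rewrite -exprVn invrN1.
have shift t : cis ((-1) ^+ sg * j%:R * (t + 2 * pi / 2) : R) =
    (-1) ^+ j * cis ((-1) ^+ sg * j%:R * t).
  by rewrite pi2 mulrDr cisD cj mulrC.
have [jo|je] := boolP (odd j).
  rewrite (davg_antiperiodic R[i] R[i]); last first.
    by move=> t; rewrite shift -signr_odd jo mulN1r.
  rewrite (_ : (_ %| _)%N = false)//; apply/negbTE.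
  apply: contraL jo => /(dvdn_trans _) d; rewrite -dvdn2; apply: d.
  by rewrite expnS dvdn_mulr.
rewrite (davg_periodic R[i] R[i]); last first.
  by move=> t; rewrite shift -signr_odd (negbTE je) mul1r.
have jE : j = (2 * j./2)%N by rewrite mul2n even_halfK.
rewrite {2}jE expnS dvdn_pmul2l// -IH.
have -> : (0 : R) = 2^-1 * 0 by rewrite mulr0.
have -> : 2 * pi / 2 = 2^-1 * (2 * pi) :> R by rewrite mulrC.
rewrite (davg_dilation R[i] R[i]) mulr0; apply: eq_davg => t; congr (cis _).
by rewrite {1}jE natrM; field.
Qed.

(** With truncated subtraction, (k - m) + (m - k) is the distance of [k] and [m]. *)
Lemma davg_power p m k (r : R) : 0 < r ->
  davg p (V := R[i])
    (fun t : R => ((r%:C)%C * cis t)^-1 ^+ m * ((r%:C)%C * cis t) ^+ k) 0 (2 * pi) =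
  ((r^-1 ^+ m * r ^+ k)%:C)%C * (2 ^ p %| (k - m) + (m - k))%N%:R.
Proof.
move=> r0.
pose sg := (k < m)%N.
have E : (-1) ^+ sg * ((k - m) + (m - k))%:R = k%:R - m%:R :> R.
  rewrite /sg; case: ltnP => km.
    have -> : (k - m + (m - k) = m - k)%N by lia.
    by rewrite expr1 mulN1r natrB ?opprB// ltnW.
  have -> : (k - m + (m - k) = k - m)%N by lia.
  by rewrite expr0 mul1r natrB.
rewrite -(davg_cis sg) -[RHS]/(_ *: _) -davgZ; apply: eq_davg => t.
rewrite E expr_quotient rmorphM/= !rmorphXn/= fmorphV/=.
by rewrite mulrBl cisD cisN -!cisX (exprVn (cis t)).
Qed.

End Orthogonality.

Lemma geometric_remainder (F : fieldType) (a z : F) n : z != 0 -> z - a != 0 ->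
  z / (z - a) = \sum_(k < n) a ^+ k * z^-1 ^+ k + (a * z^-1) ^+ n * (z / (z - a)).
Proof.
move=> z0 za; elim: n => [|n IH]; first by rewrite big_ord0 add0r expr0 mul1r.
rewrite big_ord_recr/= {1}IH -addrA; congr (_ + _).
have {1}-> : z / (z - a) = 1 + a * z^-1 * (z / (z - a)).
  by field; apply/andP.
by rewrite mulrDr mulr1 -exprMn mulrA -exprSr.
Qed.

Section Taylor.
Context {R : realType} (X : completeNormedModType R[i]).
Variables (g : R[i] -> X) (V : R).
Hypothesis gV : forall z, nrm z < 1 -> nrm (g z) <= V.
Hypothesis gd : forall z, nrm z < 1 -> differentiable g z.

Definition taylor_avg p m (r : R) : X := cavg p (fun z : R[i] => z^-1 ^+ m *: g z) r.

Lemma differentiable_taylor m (z : R[i]) : 0 < nrm z < 1 ->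
  differentiable (fun z : R[i] => z^-1 ^+ m *: g z) z.
Proof.
move=> /andP[z0 z1]; apply: differentiable_scaler; last exact: gd.
elim: m => [|m IH]; first exact: differentiable_cst.
have -> : (fun w : R[i] => w^-1 ^+ m.+1) = (fun w : R[i] => w^-1 * w^-1 ^+ m).
  by apply/funext => w; rewrite exprS.
apply: differentiable_mulc IH; apply: (differentiable_Rinv (R := R[i])).
exact: nrm_neq0.
Qed.

(** The limit is constructed at radius 1/2; [cavg_annulus] makes it the same at every other radius,
    because z^-m g(z) is holomorphic off 0. *)
Lemma taylor_coef : exists v : nat -> X, forall m (r : R), 0 < r < 1 ->
  forall e : R, 0 < e -> \forall p \near \oo, nrm (taylor_avg p m r - v m) <= e.
Proof.
have h0 : 0 < 2^-1 :> R by rewrite invr_gt0.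
have h1 : 2^-1 < 1 :> R by lra.
have : forall m, exists l : X, forall e : R, 0 < e ->
    \forall p \near \oo, nrm (taylor_avg p m 2^-1 - l) < e.
  move=> m; apply: cauchy_nrm_cvg; apply: cavg_cauchy; first exact: ltW.
  move=> z zr; apply: differentiable_nrm_near; apply: differentiable_taylor.
  by rewrite zr h0.
move=> /choice[v vP]; exists v => m r /andP[r0 r1] e e0.
have e2 : 0 < e / 2 by rewrite divr_gt0.
have : \forall p \near \oo, nrm (taylor_avg p m r - taylor_avg p m 2^-1) <= e / 2.
  have [rh|rh|->] := ltgtP r 2^-1; last by apply: nearW => p; rewrite subrr nrm0 ltW.
    have A := cavg_annulus _ (fun z : R[i] => z^-1 ^+ m *: g z) r 2^-1 r0 rh _ _ e2.
    apply: filterS (A _) => [p|z zI]; first by rewrite nrmBC.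
    by apply: differentiable_taylor; lra.
  apply: cavg_annulus => // z zI.
  by apply: differentiable_taylor; lra.
move=> A; apply: filterS (filterI A (vP m _ e2)) => p [h2 h3].
by have := nrm_tri _ (taylor_avg p m 2^-1) (taylor_avg p m r) (v m); lra.
Qed.

Variable v : nat -> X.
Hypothesis vP : forall m (r : R), 0 < r < 1 ->
  forall e : R, 0 < e -> \forall p \near \oo, nrm (taylor_avg p m r - v m) <= e.

Lemma nrm_taylor_avg p m (r : R) : 0 < r < 1 ->
  nrm (taylor_avg p m r) <= r^-1 ^+ m * V.
Proof.
move=> /andP[r0 r1]; apply: nrm_cavg_le; first exact: ltW.
move=> z zr; rewrite nrmZ nrmX nrmV zr; apply: ler_wpM2l.
  by rewrite exprn_ge0// invr_ge0 ltW.
by apply: gV; rewrite zr.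
Qed.

Lemma nrm_taylor_coef m (r : R) : 0 < r < 1 -> nrm (v m) <= r^-1 ^+ m * V.
Proof.
move=> r01; apply/ler_addgt0Pr => e /(vP m r r01) A.
have [p h] := filter_ex A; have := nrm_taylor_avg p m r r01.
by have := nrm_sub_le _ (v m) (taylor_avg p m r); rewrite nrmBC; lra.
Qed.

Lemma taylor_sum_near n (c : nat -> R[i]) (r : R) : 0 < r < 1 ->
  forall e : R, 0 < e -> \forall p \near \oo,
    nrm (\sum_(k < n) c k *: taylor_avg p k r - \sum_(k < n) c k *: v k) <= e.
Proof.
move=> r01; elim: n => [|n IH] e e0.
  by apply: nearW => p; rewrite !big_ord0 subrr nrm0 ltW.
have e2 : 0 < e / 2 by rewrite divr_gt0.
have c1 : 0 < nrm (c n) + 1 by have := nrm_ge0 _ (c n); lra.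
have e3 : 0 < e / 2 / (nrm (c n) + 1) by rewrite divr_gt0.
apply: filterS (filterI (IH _ e2) (vP n _ r01 _ e3)) => p [h1 h2].
rewrite !big_ord_recr/= opprD addrACA -scalerBr (splitr e).
apply: ler_nrmD => //; rewrite nrmZ.
apply: (@le_trans _ _ ((nrm (c n) + 1) * nrm (taylor_avg p n r - v n))).
  by apply: ler_wpM2r; [exact: nrm_ge0|lra].
by rewrite -ler_pdivlMl// mulrC.
Qed.

(** In Cauchy's formula the kernel z / (z - a) is expanded into [n.+1] geometric terms and a
    remainder, whose average is the error. *)
Lemma taylor_expansion (a : R[i]) (r : R) n : nrm a < r -> r < 1 ->
  nrm (g a - \sum_(k < n.+1) a ^+ k *: v k) <=
    (nrm a / r) ^+ n.+1 * (r / (r - nrm a) * (V + V)).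
Proof.
move=> ar r1; have r0 : 0 < r by apply: le_lt_trans ar; exact: nrm_ge0.
have r01 : 0 < r < 1 by rewrite r0.
apply/ler_addgt0Pr => e e0; have e2 : 0 < e / 2 by rewrite divr_gt0.
have gr z : nrm z <= r -> differentiable g z by move=> zr; apply: gd; lra.
have A1 := cauchy_formula _ g a r ar gr _ e2.
have A2 := taylor_sum_near n.+1 (fun k => a ^+ k) r r01 _ e2.
(* Then n < 2^p, so no exponent k with 0 < k <= n is a multiple of 2^p, and of the terms with [g a]
   only the one for k = 0 survives. *)
have A3 : \forall p \near \oo, (n < p)%N by exists n.+1.
have [p [[h1 h2] np]] := filter_ex (filterI (filterI A1 A2) A3).
have pi0 : 0 <= 2 * pi :> R by rewrite mulr_ge0// pi_ge0.
pose rem := cavg p (fun z : R[i] => ((a * z^-1) ^+ n.+1 * (z / (z - a))) *: (g z - g a)) r.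
have remB : nrm rem <= (nrm a / r) ^+ n.+1 * (r / (r - nrm a) * (V + V)).
  apply: nrm_cavg_le; first exact: ltW.
  move=> z zr; have za : r - nrm a <= nrm (z - a) by rewrite -zr; exact: nrm_sub_le.
  rewrite nrmZ nrmM nrmX nrmM nrmV nrmM nrmV zr -mulrA.
  apply: ler_wpM2l; first by rewrite exprn_ge0// divr_ge0 ?nrm_ge0 ?ltW.
  apply: ler_pM => //; [|exact: nrm_ge0| |].
  - by rewrite divr_ge0 ?nrm_ge0 ?ltW.
  - by rewrite ler_pM2l// lef_pV2 ?posrE//; lra.
  - by apply: ler_nrmB; apply: gV; lra.
have zr t : nrm ((r%:C)%C * cis t) = r by apply: nrm_circle; exact: ltW.
have E : cavg p (fun z : R[i] => (z / (z - a)) *: (g z - g a)) r =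
    \sum_(k < n.+1) a ^+ k *: taylor_avg p k r - g a + rem.
  transitivity (\sum_(k < n.+1) a ^+ k *: (taylor_avg p k r -
      davg p (fun t => ((r%:C)%C * cis t)^-1 ^+ k *: g a) 0 (2 * pi)) + rem).
    have -> : \sum_(k < n.+1) a ^+ k *: (taylor_avg p k r -
        davg p (fun t => ((r%:C)%C * cis t)^-1 ^+ k *: g a) 0 (2 * pi)) =
      \sum_(k < n.+1) davg p (fun t => a ^+ k *: (((r%:C)%C * cis t)^-1 ^+ k *:
         (g ((r%:C)%C * cis t) - g a))) 0 (2 * pi).
      apply: eq_bigr => k _; rewrite davgZ; congr (_ *: _).
      by rewrite -davgB; apply: eq_davg => t; rewrite scalerBr.
    rewrite -(davg_sum _ _ p (fun k t => a ^+ k *: (((r%:C)%C * cis t)^-1 ^+ k *: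
         (g ((r%:C)%C * cis t) - g a)))) -davgD; apply: eq_davg => t.
    have z0 : (r%:C)%C * cis t != 0 by apply: nrm_neq0; rewrite zr.
    have za : (r%:C)%C * cis t - a != 0.
      rewrite subr_eq0; apply: contraTneq ar => <-; by rewrite zr ltxx.
    rewrite {1}(geometric_remainder _ _ _ n.+1 z0 za) scalerDl scaler_suml.
    by congr (_ + _); apply: eq_bigr => k _; rewrite scalerA.
  congr (_ + _); rewrite (eq_bigr (fun k : 'I_n.+1 => a ^+ k *: taylor_avg p k r -
     (if k == ord0 then g a else 0))); last first.
    move=> k _; rewrite scalerBr; congr (_ - _).
    rewrite davg_scalel.
    have -> : davg p (V := R[i]^o) (fun t => ((r%:C)%C * cis t)^-1 ^+ k) 0 (2 * pi) =
        ((r^-1 ^+ k * r ^+ 0)%:C)%C * (2 ^ p %| (0 - k) + (k - 0))%N%:R.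
      rewrite -(davg_power p k 0 r r0); apply: eq_davg => t.
      by rewrite expr0 mulr1.
    rewrite sub0n add0n subn0; have [->|k0] := eqVneq k ord0.
      by rewrite /= dvdn0 !expr0 !mulr1 !scale1r.
    rewrite gtnNdvd ?mulr0 ?scale0r ?scaler0//; first by rewrite lt0n.
    exact: leq_ltn_trans (ltnW (leq_ltn_trans (ltn_ord k : (k <= n)%N) np)) (@ltn_expl 2 p isT).
  rewrite sumrB; congr (_ - _).
  by rewrite -big_mkcond big_pred1_eq.
have -> : g a - \sum_(k < n.+1) a ^+ k *: v k =
  rem + ((\sum_(k < n.+1) a ^+ k *: taylor_avg p k r - \sum_(k < n.+1) a ^+ k *: v k)
  - cavg p (fun z : R[i] => (z / (z - a)) *: (g z - g a)) r).
  rewrite E; clear remB E; move: (\sum_(k < n.+1) _) (\sum_(k < n.+1) _) (g a) rem => x y z u.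
  by zmod.
by apply: ler_nrmD remB _; rewrite (splitr e); exact: ler_nrmB.
Qed.

End Taylor.

(** * Lifting the Taylor coefficients to [H1] *)

Lemma sum_congruent (V : nmodType) (F : nat -> V) (m n L : nat) : (m < n)%N ->
  \sum_(k < L * n) (if (n %| (k - m) + (m - k))%N then F k else 0) =
  \sum_(l < L) F (m + l * n)%N.
Proof.
move=> mn.
have E k : (n %| (k - m) + (m - k))%N = (k == m %[mod n]).
  have [km|mk] := ltnP k m.
    have -> : (k - m + (m - k) = m - k)%N by lia.
    by rewrite eq_sym eqn_mod_dvd// ltnW.
  have -> : (k - m + (m - k) = k - m)%N by lia.
  by rewrite eqn_mod_dvd.
elim: L => [|L IH]; first by rewrite mul0n !big_ord0.
rewrite big_ord_recr/= -IH mulSn addnC big_split_ord/=; congr (_ + _).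
rewrite (bigD1 (Ordinal mn))//= E modnMDl eqxx addnC big1 ?addr0// => i im.
rewrite E modnMDl !modn_small//; case: eqP => // imE.
by move: im; rewrite -val_eqE/= imE eqxx.
Qed.

Section Aliasing.
Context {R : realType} (X : completeNormedModType R[i]).
Variables (g : R[i] -> X) (V : R).
Hypothesis gV : forall z, nrm z < 1 -> nrm (g z) <= V.
Hypothesis gd : forall z, nrm z < 1 -> differentiable g z.
Variable v : nat -> X.
Hypothesis vP : forall m (r : R), 0 < r < 1 ->
  forall e : R, 0 < e -> \forall p \near \oo, nrm (taylor_avg X g p m r - v m) <= e.

(** On the circle [g] is replaced by its Taylor polynomial with L 2^p terms, which the grid average
    maps exactly to the folded sum. The error is uniform on the circle and decays geometrically in
    [L]. *)
Lemma aliasing p m (r : R) : (m < 2 ^ p)%N -> 0 < r < 1 ->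
  forall e : R, 0 < e -> \forall L \near \oo,
  nrm (taylor_avg X g p m r -
       \sum_(l < L) ((r ^+ (l * 2 ^ p))%:C)%C *: v (m + l * 2 ^ p)%N) <= e.
Proof.
move=> mp /andP[r0 r1] e e0.
(* An auxiliary radius strictly between [r] and 1 supplies the decay rate r / r'. *)
pose r' := (r + 1) / 2; have r'1 : r' < 1 by rewrite /r'; lra.
have rr' : r < r' by rewrite /r'; lra.
pose D := r' / (r' - r) * (V + V).
have V0 : 0 <= V by apply: le_trans (nrm_ge0 _ _) (gV 0 _); rewrite nrm0 ltr01.
have D0 : 0 <= D by rewrite /D mulr_ge0// ?divr_ge0//; lra.
have q0 : 0 <= r / r' < 1 by rewrite divr_ge0 ?ltr_pdivrMr; lra.
have near := near_geometric_lt (r^-1 ^+ m * D) _ _ q0 e0.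
have pos : \forall L \near \oo, (0 < L)%N by exists 1%N.
apply: filterS (filterI near pos) => L [small L0].
have n0 : (0 < 2 ^ p)%N by rewrite expn_gt0.
have zr t : nrm ((r%:C)%C * cis t) = r by apply: nrm_circle; exact: ltW.
have -> : \sum_(l < L) ((r ^+ (l * 2 ^ p))%:C)%C *: v (m + l * 2 ^ p)%N =
  davg p (fun t => \sum_(k < L * 2 ^ p)
     (((r%:C)%C * cis t)^-1 ^+ m * ((r%:C)%C * cis t) ^+ k) *: v k) 0 (2 * pi).
  rewrite (davg_sum _ _ p (fun k t =>
     (((r%:C)%C * cis t)^-1 ^+ m * ((r%:C)%C * cis t) ^+ k) *: v k)).
  pose F k := ((r^-1 ^+ m * r ^+ k)%:C)%C *: v k.
  transitivity (\sum_(l < L) F (m + l * 2 ^ p)%N).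
    apply: eq_bigr => l _; rewrite /F exprD mulrA -exprMn mulVf ?gt_eqF//.
    by rewrite expr1n mul1r.
  rewrite -(sum_congruent X F m (2 ^ p) L mp); apply: eq_bigr => k _.
  rewrite davg_scalel (davg_power p m k r r0) /F.
  by case: ifP => _; rewrite ?mulr1// mulr0 scale0r.
rewrite -davgB; apply: (@le_trans _ _ (r^-1 ^+ m * D * (r / r') ^+ L)); last exact: ltW.
apply: nrm_davg_le; first by rewrite mulr_ge0// pi_ge0.
move=> t _; set z := _ * cis t.
have -> : z^-1 ^+ m *: g z - \sum_(k < L * 2 ^ p) (z^-1 ^+ m * z ^+ k) *: v k =
    z^-1 ^+ m *: (g z - \sum_(k < L * 2 ^ p) z ^+ k *: v k).
  by rewrite scalerBr scaler_sumr; congr (_ - _); apply: eq_bigr => k _; rewrite scalerA.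
rewrite nrmZ nrmX nrmV zr -mulrA; apply: ler_wpM2l.
  by rewrite exprn_ge0// invr_ge0 ltW.
have [K KE] : exists K, (L * 2 ^ p = K.+1)%N.
  by exists (L * 2 ^ p).-1; rewrite prednK// muln_gt0 L0.
have zr' : nrm z < r' by rewrite zr.
rewrite KE; apply: le_trans (taylor_expansion X g V gV gd v vP z r' K zr' r'1) _.
rewrite zr -/D -KE mulrC; apply: ler_wpM2l => //.
by apply: ler_wiXn2l; rewrite ?leq_pmulr//; lra.
Qed.

End Aliasing.

Section GeometricSeries.
Context {R : realType}.

Lemma geometric_cvg (X : completeNormedModType R[i]) (u : nat -> X) (C q : R) :
  0 <= q < 1 -> (forall n, nrm (u n.+1 - u n) <= C * q ^+ n) ->
  exists l : X, forall e : R, 0 < e -> \forall n \near \oo, nrm (u n - l) < e.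
Proof.
move=> /andP[q0 q1] uC; apply: cauchy_nrm_cvg => e e0.
have C0 : 0 <= C by have := le_trans (nrm_ge0 _ _) (uC 0%N); rewrite expr0 mulr1.
pose D := C / (1 - q).
have D0 : 0 <= D by rewrite /D divr_ge0//; lra.
have step n d : nrm (u (n + d)%N - u n) <= D * q ^+ n * (1 - q ^+ d).
  elim: d => [|d IH]; first by rewrite addn0 subrr nrm0 expr0 subrr mulr0.
  have -> : D * q ^+ n * (1 - q ^+ d.+1) = C * q ^+ (n + d) + D * q ^+ n * (1 - q ^+ d).
    rewrite exprD exprS /D; field; lra.
  rewrite addnS -(subrKA (u (n + d)%N)); apply: ler_nrmD => //.
have q01 : 0 <= q < 1 by rewrite q0.
have e2 : 0 < e / 2 by rewrite divr_gt0.
have [N NP] := filter_ex (near_geometric_lt D _ _ q01 e2).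
have key n : (N <= n)%N -> nrm (u n - u N) < e / 2.
  move=> Nn; apply: le_lt_trans NP.
  rewrite -(subnKC Nn); apply: le_trans (step _ _) _.
  rewrite -[leRHS]mulr1; apply: ler_wpM2l; first by rewrite mulr_ge0// exprn_ge0.
  by rewrite gerBl exprn_ge0.
exists N => m n /key hm /key hn.
by have := nrm_tri _ (u N) (u m) (u n); rewrite (nrmBC _ (u N)); lra.
Qed.

(** The weights 3^-(l+1) sum to 1/2, the contraction constant of the Neumann iteration. The factor
    [q] is 1 for full sums and 3^-k for tails. *)
Lemma nrm_third_sum (X : normedModType R[i]) (c : nat -> R[i]) (x : nat -> X)
    (q C : R) k : 0 <= q -> 0 <= C ->
  (forall l, nrm (c l) <= q * 3^-1 ^+ l.+1) -> (forall l, nrm (x l) <= C) ->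
  nrm (\sum_(l < k) c l *: x l) <= q * C / 2.
Proof.
move=> q0 C0 cq xC.
suff h : nrm (\sum_(l < k) c l *: x l) <= q * C / 2 * (1 - 3^-1 ^+ k).
  apply: le_trans h _; rewrite -[leRHS]mulr1; apply: ler_wpM2l.
    by rewrite divr_ge0// mulr_ge0.
  by rewrite gerBl exprn_ge0// invr_ge0.
elim: k => [|k IH]; first by rewrite big_ord0 nrm0 expr0 subrr mulr0.
rewrite big_ord_recr/=.
have -> : q * C / 2 * (1 - 3^-1 ^+ k.+1) =
   q * C / 2 * (1 - 3^-1 ^+ k) + q * 3^-1 ^+ k.+1 * C by rewrite exprS; field.
by apply: ler_nrmD => //; rewrite nrmZ; apply: ler_pM; rewrite ?nrm_ge0.
Qed.

End GeometricSeries.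

(** * Inversion of the aliased system in the smaller space *)

Section NeumannLift.
Context {R : realType} (H0 : normedModType R[i]) (H1 : completeNormedModType R[i]).
Variables (j : {linear H1 -> H0}) (B : R).
Hypothesis jB : forall y, nrm (j y) <= B * nrm y.
Variables (v : nat -> H0) (s : nat -> H1) (c : nat -> nat -> R[i]).
Variables (ix : nat -> nat -> nat) (W A : R).
Hypothesis vW : forall m, nrm (v m) <= W.
Hypothesis sA : forall m, nrm (s m) <= A.
Hypothesis c3 : forall m l, nrm (c m l) <= 3^-1 ^+ l.+1.
Hypothesis vs : forall m (e : R), 0 < e -> \forall L \near \oo,
  nrm (j (s m) - (v m + \sum_(l < L) c m l *: v (ix m l))) <= e.

(* The contraction [b = s - c b] is solved in [H1] by iteration; truncating the
   sums at the iteration index keeps them finite. *)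
Fixpoint neumann k m : H1 :=
  if k is k'.+1 then s m - \sum_(l < k') c m l *: neumann k' (ix m l) else 0.

Let A0 : 0 <= A. Proof. exact: le_trans (nrm_ge0 _ _) (sA 0%N). Qed.
Let W0 : 0 <= W. Proof. exact: le_trans (nrm_ge0 _ _) (vW 0%N). Qed.

Lemma neumannS k m :
  neumann k.+1 m = s m - \sum_(l < k) c m l *: neumann k (ix m l).
Proof. by []. Qed.

Lemma nrm_neumann k m : nrm (neumann k m) <= 2 * A.
Proof.
elim: k m => [|k IH] m /=; first by rewrite nrm0 mulr_ge0.
have -> : 2 * A = A + 1 * (2 * A) / 2 by field.
apply: ler_nrmB => //; apply: (nrm_third_sum _ (c m) (fun l => neumann k (ix m l))) => //.
  by rewrite mulr_ge0.
by move=> l; rewrite mul1r.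
Qed.

(** A step contracts the previous difference by 1/2 and admits one new term of size 2 A 3^-(k+1).
    The ratio 2/3 with constant 6 absorbs both. *)
Lemma neumann_step k m : nrm (neumann k.+1 m - neumann k m) <= 6 * A * (2 / 3) ^+ k.
Proof.
elim: k m => [|k IH] m.
  rewrite /= big_ord0 !subr0 expr0 mulr1; apply: le_trans (sA m) _; move: A0; lra.
have -> : neumann k.+2 m - neumann k.+1 m =
    - (\sum_(l < k) c m l *: (neumann k.+1 (ix m l) - neumann k (ix m l))
       + c m k *: neumann k.+1 (ix m k)).
  rewrite (neumannS k.+1 m) (neumannS k m) big_ord_recr/=.
  rewrite [in RHS](eq_bigr _ (fun l _ => scalerBr _ _ _)) sumrB.
  by move: (\sum_(l < k) _) (\sum_(l < k) _) (_ *: _) (s m) => x y z u; zmod.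
rewrite nrmN.
have a0 : 0 <= 6 * A * (2 / 3) ^+ k.
  by rewrite mulr_ge0 ?exprn_ge0 ?mulr_ge0//; lra.
apply: (@le_trans _ _ (1 * (6 * A * (2 / 3) ^+ k) / 2 + 3^-1 ^+ k.+1 * (2 * A))).
  apply: ler_nrmD.
    apply: (nrm_third_sum _ (c m) (fun l => neumann k.+1 (ix m l) - neumann k (ix m l))) => //.
    by move=> l; rewrite mul1r.
  by rewrite nrmZ; apply: ler_pM; rewrite ?nrm_ge0 ?nrm_neumann.
have h : A * 3^-1 ^+ k <= A * (2 / 3) ^+ k.
  by apply: (ler_wpM2l A0); apply: lerXn2r; rewrite ?nnegrE; lra.
by rewrite !exprS; lra.
Qed.

Lemma truncation_error k m :
  nrm (j (s m) - (v m + \sum_(l < k) c m l *: v (ix m l))) <= 3^-1 ^+ k * W / 2.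
Proof.
apply/ler_addgt0Pr => e /(vs m) vse.
have ge : \forall L \near \oo, (k <= L)%N by exists k.
have [L [h kL]] := filter_ex (filterI vse ge).
rewrite -(subnKC kL) big_split_ord/= in h.
set d := (L - k)%N in h.
have t : nrm (\sum_(l < d) c m (k + l)%N *: v (ix m (k + l)%N)) <= 3^-1 ^+ k * W / 2.
  apply: (nrm_third_sum _ (fun l => c m (k + l)%N) (fun l => v (ix m (k + l)%N))) => //.
  by move=> l; rewrite -exprD addnS.
have -> : j (s m) - (v m + \sum_(l < k) c m l *: v (ix m l)) =
  \sum_(l < d) c m (k + l)%N *: v (ix m (k + l)%N) +
  (j (s m) - (v m + (\sum_(l < k) c m l *: v (ix m l) +
    \sum_(l < d) c m (k + l)%N *: v (ix m (k + l)%N)))).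
  by move: (\sum_(l < k) _) (\sum_(l < d) _) (j (s m)) (v m) => x y z u; zmod.
exact: ler_nrmD.
Qed.

(** In [H0] the sequence [v] solves the untruncated system, so the error obeys the same contraction,
    with the truncation error W 3^-k / 2 as inhomogeneity. *)
Lemma neumann_error k m : nrm (j (neumann k m) - v m) <= 3 * W * (2 / 3) ^+ k.
Proof.
elim: k m => [|k IH] m.
  rewrite /= linear0 sub0r nrmN expr0 mulr1; apply: le_trans (vW m) _; move: W0; lra.
have -> : j (neumann k.+1 m) - v m =
    (j (s m) - (v m + \sum_(l < k) c m l *: v (ix m l))) -
    \sum_(l < k) c m l *: (j (neumann k (ix m l)) - v (ix m l)).
  rewrite /= linearB linear_sum /= (eq_bigr _ (fun l _ => linearZ _ _)).
  rewrite [in RHS](eq_bigr _ (fun l _ => scalerBr _ _ _)) sumrB.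
  by move: (\sum_(l < k) _) (\sum_(l < k) _) (j (s m)) (v m) => x y z u; zmod.
have a0 : 0 <= 3 * W * (2 / 3) ^+ k.
  by rewrite mulr_ge0 ?exprn_ge0 ?mulr_ge0//; lra.
apply: (@le_trans _ _ (3^-1 ^+ k * W / 2 + 1 * (3 * W * (2 / 3) ^+ k) / 2)).
  apply: ler_nrmB; first exact: truncation_error.
  apply: (nrm_third_sum _ (c m) (fun l => j (neumann k (ix m l)) - v (ix m l))) => //.
  by move=> l; rewrite mul1r.
have h : W * 3^-1 ^+ k <= W * (2 / 3) ^+ k.
  by apply: (ler_wpM2l W0); apply: lerXn2r; rewrite ?nnegrE; lra.
by rewrite exprS; lra.
Qed.

Lemma neumann_lift : exists b : nat -> H1, forall m, j (b m) = v m /\ nrm (b m) <= 2 * A.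
Proof.
have q01 : 0 <= (2 / 3 : R) < 1 by lra.
have /choice[b bP] : forall m, exists l : H1, forall e : R, 0 < e ->
    \forall n \near \oo, nrm (neumann n m - l) < e.
  by move=> m; apply: (geometric_cvg _ _ (6 * A) (2 / 3)) => // n; exact: neumann_step.
exists b => m; split; last first.
  by apply: (nrm_near_le _ _ _ _ (bP m)); apply: nearW => n; exact: nrm_neumann.
have B0 : 0 < `|B| + 1 by have := normr_ge0 B; lra.
apply: (nrm_lim_uniq _ (fun n => j (neumann n m))).
  move=> e e0; have e1 : 0 < e / (`|B| + 1) by rewrite divr_gt0.
  apply: filterS (bP m _ e1) => n h; rewrite -linearB.
  apply: le_lt_trans (jB _) _.
  apply: (@le_lt_trans _ _ ((`|B| + 1) * nrm (neumann n m - b m))).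
    by apply: ler_wpM2r; [exact: nrm_ge0|have := ler_norm B; lra].
  by rewrite -ltr_pdivlMl// mulrC.
move=> e e0; apply: filterS (near_geometric_lt (3 * W) _ _ q01 e0) => k.
by apply: le_lt_trans; exact: neumann_error.
Qed.

End NeumannLift.

Lemma bounded_of_continuous (R : realType) (X Y : normedModType R[i])
  (j : {linear X -> Y}) : continuous j -> exists B : R, forall y, nrm (j y) <= B * nrm y.
Proof.
move=> jc; have /(cvg_nrm _ _ _ j (j 0)).1/(_ _ ltr01)/nbhs_nrm[d d0 dP] := jc 0.
exists (2 / d) => y; have [->|y0] := eqVneq y 0; first by rewrite linear0 !nrm0 mulr0.
have n0 : 0 < nrm y.
  by apply: nrm_gt0.
pose a : R := d / 2 / nrm y; have a0 : 0 < a by rewrite !divr_gt0.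
have := dP ((a%:C)%C *: y); rewrite linear0 !subr0 linearZ/= !nrmZ nrmR gtr0_norm//.
have -> : a * nrm y = d / 2 by rewrite /a divfK// gt_eqF.
have dd : d / 2 < d by lra.
move=> /(_ dd) h; have -> : 2 / d * nrm y = a^-1 by rewrite /a; field; rewrite !gt_eqF.
by rewrite -[leRHS]mulr1 ler_pdivlMl// ltW.
Qed.

(** * A Schwarz-type estimate in the smaller space *)

Section Schwarz.
Context {R : realType} (H0 H1 : completeNormedModType R[i]).
Variable j : {linear H1 -> H0}.
Hypotheses (j_inj : injective j) (j_cont : continuous j).

Lemma bernoulli_ineq (x : R) n : 0 <= x <= 1 -> 1 - n%:R * x <= (1 - x) ^+ n.
Proof.
move=> /andP[x0 x1]; elim: n => [|n IH]; first by rewrite mul0r subr0 expr0.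
rewrite exprS; have := ler_wpM2l (_ : 0 <= 1 - x) IH.
have n0 : 0 <= n%:R * x * x by rewrite !mulr_ge0.
by rewrite subr_ge0 => /(_ x1); rewrite -natr1; lra.
Qed.

Lemma sampling_radius m : exists r p,
  [/\ 0 < (r : R) < 1, (m < 2 ^ p)%N, r^-1 ^+ m <= 2 & r ^+ (2 ^ p) <= 3^-1].
Proof.
have m0 : 0 <= m%:R :> R by [].
(* For the radius 1 - x, Bernoulli's inequality gives (1 - x)^m >= 1 - m x >= 1/2. Only afterwards
   is the number of points chosen, large enough for this radius. *)
pose x : R := (2 * (m%:R + 1))^-1.
have x0 : 0 < x by rewrite invr_gt0; lra.
have x1 : x <= 2^-1 by rewrite lef_pV2 ?posrE; lra.
have mx : m%:R * x <= 2^-1.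
  by rewrite /x ler_pdivrMr; lra.
have r01 : 0 < 1 - x < 1 by lra.
have [N _ NP] : \forall n \near \oo, 1 * (1 - x) ^+ n < 3^-1.
  by apply: near_geometric_lt; [lra|rewrite invr_gt0].
have lt2 : (N + m < 2 ^ (N + m))%N by exact: ltn_expl.
exists (1 - x), (N + m)%N; split => //.
- by apply: leq_ltn_trans lt2; exact: leq_addl.
- have : 2^-1 <= (1 - x) ^+ m.
    by apply: le_trans (bernoulli_ineq x m _); lra.
  by rewrite exprVn -(invrK 2) lef_pV2 ?posrE ?invr_gt0 ?exprn_gt0//; lra.
- rewrite -[leLHS]mul1r; apply/ltW/NP => /=; apply: leq_trans (ltnW lt2); exact: leq_addr.
Qed.

Lemma davg_linear p (h : R -> H1) a s :
  j (davg p h a s) = davg p (fun t => j (h t)) a s.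
Proof. by elim: p a s => [//|p IH] a s /=; rewrite linearZ/= linearD !IH. Qed.

(* Although [G] is holomorphic only as an [H0]-valued map, its Taylor
   coefficients lie in [H1] with a bound depending only on [M]. *)
Lemma schwarz_lift (G : R[i] -> H1) (M : R) :
  (forall z, nrm z < 1 -> nrm (G z) <= M) ->
  (forall z, nrm z < 1 -> differentiable (fun w => j (G w)) z) ->
  forall z, nrm z <= 2^-1 -> nrm (G z - G 0) <= 8 * M * nrm z.
Proof.
move=> GM dG; have [B jB] := bounded_of_continuous _ _ _ _ j_cont.
pose V := `|B| * M; pose g w := j (G w).
have M0 : 0 <= M by apply: le_trans (nrm_ge0 _ _) (GM 0 _); rewrite nrm0 ltr01.
have V0 : 0 <= V by rewrite mulr_ge0.
have gV z : nrm z < 1 -> nrm (g z) <= V.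
  move=> /GM h; apply: le_trans (jB _) _.
  apply: (@le_trans _ _ (`|B| * nrm (G z))).
    by apply: ler_wpM2r; [exact: nrm_ge0|exact: ler_norm].
  by apply: ler_wpM2l.
have [v vP] := taylor_coef _ g dG.
have /choice[rp rpP] m : exists x : R * nat, [/\ 0 < x.1 < 1, (m < 2 ^ x.2)%N,
    x.1^-1 ^+ m <= 2 & x.1 ^+ (2 ^ x.2) <= 3^-1].
  by have [r [p h]] := sampling_radius m; exists (r, p).
pose s m := cavg (rp m).2 (fun z => z^-1 ^+ m *: G z) (rp m).1.
have sM m : nrm (s m) <= 2 * M.
  have [/andP[r0 r1] _ rm _] := rpP m; apply: nrm_cavg_le; first exact: ltW.
  move=> z zr; rewrite nrmZ nrmX nrmV zr; apply: ler_pM => //; last by apply: GM; rewrite zr.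
    by rewrite exprn_ge0// invr_ge0 ltW.
  exact: nrm_ge0.
have vW m : nrm (v m) <= 2 * V.
  have [r01 _ rm _] := rpP m.
  apply: le_trans (nrm_taylor_coef _ g V gV v vP m _ r01) _.
  by apply: ler_wpM2r.
(* The shift to [l.+1] sets apart the term l = 0 of the aliasing sum, which is [v m] itself. *)
pose c m l : R[i] := (((rp m).1 ^+ (l.+1 * 2 ^ (rp m).2))%:C)%C.
pose ix m l := (m + l.+1 * 2 ^ (rp m).2)%N.
have c3 m l : nrm (c m l) <= 3^-1 ^+ l.+1.
  have [/andP[r0 r1] _ _ rn] := rpP m.
  have {}r0 := ltW r0; rewrite nrmR ger0_norm ?exprn_ge0// mulnC exprM.
  by apply: lerXn2r; rewrite ?nnegrE ?exprn_ge0 ?invr_ge0.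
have vs m (e : R) : 0 < e -> \forall L \near \oo,
    nrm (j (s m) - (v m + \sum_(l < L) c m l *: v (ix m l))) <= e.
  move=> e0; have [r01 mp _ _] := rpP m.
  have [N _ NP] := aliasing _ g V gV dG v vP _ m _ mp r01 e e0.
  exists N => // L NL; have := NP L.+1 (leqW NL).
  rewrite /= big_ord_recl/= mul0n addn0 expr0 scale1r.
  rewrite /s /cavg davg_linear /taylor_avg /cavg.
  by congr (nrm (_ - _) <= _); apply: eq_davg => t; rewrite linearZ.
have [b bP] := neumann_lift H0 H1 j B jB v s c ix _ _ vW sM c3 vs.
have bM m : nrm (b m) <= 4 * M by have [_] := bP m; lra.
(* Injectivity of [j] reduces this to v_0 = g(0), the Taylor estimate at the point 0, whose error
   bound is zero. *)
have b0 : b 0%N = G 0.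
  apply: j_inj; have [-> _] := bP 0%N.
  have z0 : nrm (0 : R[i]) < 2^-1 :> R by rewrite nrm0 invr_gt0.
  have h1 : 2^-1 < 1 :> R by lra.
  have := taylor_expansion _ g V gV dG v vP 0 2^-1 0 z0 h1.
  rewrite nrm0 mul0r expr1 mul0r big_ord_recr big_ord0 /= expr0 scale1r add0r => h.
  apply/esym/eqP; rewrite -subr_eq0; apply/eqP/nrm_eq0/eqP.
  by rewrite eq_le h nrm_ge0.
move=> z z2; pose u n := \sum_(k < n.+1) z ^+ k *: b k.
have z0 := nrm_ge0 _ z.
have zb n m : nrm (z ^+ n *: b m) <= 2^-1 ^+ n * (4 * M).
  rewrite nrmZ nrmX; apply: ler_pM; rewrite ?exprn_ge0 ?nrm_ge0//.
  by apply: lerXn2r; rewrite ?nnegrE// invr_ge0.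
have [P uP] : exists l : H1, forall e : R, 0 < e -> \forall n \near \oo, nrm (u n - l) < e.
  apply: (geometric_cvg _ _ (4 * M) 2^-1); first by lra.
  move=> n; rewrite {1}/u big_ord_recr/= -/(u n) addrAC subrr add0r; apply: le_trans (zb _ _) _.
  rewrite mulrC; apply: ler_wpM2l; first by rewrite mulr_ge0.
  by apply: ler_wiXn2l => //; lra.
(* The power series converges in [H1], while its image in [H0] is the Taylor series of [g];
   injectivity of [j] identifies the sum. *)
have PG : P = G z.
  apply: j_inj; apply: (nrm_lim_uniq _ (fun n => j (u n))).
    move=> e e0; have B0 : 0 < `|B| + 1 by have := normr_ge0 B; lra.
    have e1 : 0 < e / (`|B| + 1) by rewrite divr_gt0.
    apply: filterS (uP _ e1) => n h; rewrite -linearB.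
    apply: le_lt_trans (jB _) _.
    apply: (@le_lt_trans _ _ ((`|B| + 1) * nrm (u n - P))).
      by apply: ler_wpM2r; [exact: nrm_ge0|have := ler_norm B; lra].
    by rewrite -ltr_pdivlMl// mulrC.
  move=> e e0; have zr : nrm z < 3 / 4 by lra.
  have r1 : 3 / 4 < 1 :> R by lra.
  pose D : R := 3 / 4 / (3 / 4 - nrm z) * (V + V).
  have q1 : nrm z / (3 / 4) < 1 by rewrite ltr_pdivrMr; lra.
  have q0 : 0 <= nrm z / (3 / 4) by rewrite divr_ge0.
  have q01 : 0 <= nrm z / (3 / 4) < 1 by rewrite q0.
  have [N _ NP] := near_geometric_lt D _ _ q01 e0; exists N => // n Nn.
  apply: le_lt_trans (NP n.+1 (leqW Nn)); rewrite nrmBC mulrC.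
  have -> : j (u n) = \sum_(k < n.+1) z ^+ k *: v k.
    rewrite /u linear_sum; apply: eq_bigr => k _; rewrite linearZ/=.
    by have [-> _] := bP k.
  exact: (taylor_expansion _ g V gV dG v vP z _ n zr r1).
(* One factor |z| is kept and the others are bounded by 1/2, so the terms with k >= 1 add up to at
   most |z| (4 M) (1 + 1/2 + 1/4 + ...). *)
have step n : nrm (u n - b 0%N) <= 8 * M * nrm z * (1 - 2^-1 ^+ n).
  elim: n => [|n IH].
    by rewrite /u big_ord_recr big_ord0/= !expr0 scale1r add0r !subrr nrm0 mulr0.
  rewrite /u big_ord_recr/= -/(u n) addrAC.
  have -> : 8 * M * nrm z * (1 - 2^-1 ^+ n.+1) =
     8 * M * nrm z * (1 - 2^-1 ^+ n) + nrm z * (2^-1 ^+ n * (4 * M)).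
    by rewrite exprS; field.
  apply: ler_nrmD => //; rewrite exprS -scalerA nrmZ.
  by apply: ler_wpM2l.
rewrite -b0 -PG; apply: (nrm_near_le _ (fun n => u n - b 0%N)).
  move=> e e0; apply: filterS (uP _ e0) => n.
  by rewrite opprB addrA subrK.
apply: nearW => n; apply: le_trans (step n) _.
rewrite -[leRHS]mulr1; apply: ler_wpM2l; first by rewrite !mulr_ge0.
by rewrite gerBl exprn_ge0// invr_ge0.
Qed.

End Schwarz.

(** * The interpolation theorem *)

(** The weight uses the logarithms of both constants, whose positivity is not assumed in the
    theorem; each is enlarged to a positive one at arbitrarily small cost in the power. *)
Lemma powR_approx (R : realType) (C t d : R) : 0 <= t -> 0 < d ->
  exists C', [/\ 0 < C', C <= C' & C' `^ t <= C `^ t + d].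
Proof.
move=> t0 d0; have [Cn|Cp|->] := ltgtP C 0.
(* For a negative base [powR] is exp(t ln C) with ln C = 0, hence equals 1. *)
- exists 1; split => //; first by lra.
  by rewrite powR1 /powR lt_eqF// ln0 ?mulr0 ?expR0 ?lerDl ltW.
- by exists C; split => //; rewrite lerDl ltW.
- move: t0; rewrite le_eqVlt => /predU1P[<-|t0].
    by exists 1; rewrite !powRr0 lerDl ltr01 ler01 ltW.
  exists (d `^ t^-1); rewrite powR_gt0// powR_ge0; split => //.
  by rewrite -powRrM mulVf ?gt_eqF// powRr1 ?(ltW d0)// lerDr powR_ge0.
Qed.

Section InterpolationNorm.
Context {R : realType} (X0 X1 : completeNormedModType R[i]).
Implicit Types (j : X1 -> X0) (f : R[i] -> X0).

Lemma F_norm_le j f (c : R) :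
  (forall t, nrm (f (Complex 0 t)) <= c) ->
  (forall t y, j y = f (Complex 1 t) -> nrm y <= c) -> (F_norm j f <= c%:E)%E.
Proof.
move=> f0 f1; rewrite /F_norm ge_max; apply/andP; split;
  apply: ge_ereal_sup.
  by move=> _ [t _ <-]; rewrite lee_fin.
by move=> _ [y [t yt] <-]; rewrite lee_fin; exact: f1 yt.
Qed.

Lemma F_norm_ge j f (c : R) : (F_norm j f <= c%:E)%E ->
  (forall t, nrm (f (Complex 0 t)) <= c) /\
  (forall t y, j y = f (Complex 1 t) -> nrm y <= c).
Proof.
rewrite /F_norm ge_max => /andP[f0 f1]; split => [t|t y yt].
  by rewrite -lee_fin; apply: le_trans f0; apply: ereal_sup_ubound; exists t.
by rewrite -lee_fin; apply: le_trans f1; apply: ereal_sup_ubound; exists y => //; exists t.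
Qed.

Lemma F_norm_ge0 j f : (0 <= F_norm j f)%E.
Proof.
rewrite /F_norm le_max; apply/orP; left.
apply: (@le_trans _ _ (nrm (f (Complex 0 0)))%:E); first by rewrite lee_fin nrm_ge0.
by apply: ereal_sup_ubound; exists 0.
Qed.

Lemma interp_norm_ge0 j theta (x : X0) : (0 <= interp_norm j theta x)%E.
Proof. by apply: le_ereal_inf_tmp => _ [f _ <-]; exact: F_norm_ge0. Qed.

Lemma interp_norm_lt j theta (x : X0) (c : R) : (interp_norm j theta x < c%:E)%E ->
  exists f (nu : R), [/\ in_F j f, f (theta%:C)%C = x, (F_norm j f <= nu%:E)%E & nu < c].
Proof.
move=> /ereal_inf_lt[_ [f [fF fx] <-]] fc.
have := F_norm_ge0 j f; case E : (F_norm j f) fc => [nu| |] // nuc _.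
by exists f, nu; rewrite E -lte_fin.
Qed.

End InterpolationNorm.

(** * Continuity into the smaller space and the weighted competitor *)

Section Nonlinear.
Context {R : realType} (E0 E1 H0 H1 : completeNormedModType R[i]).
Variables (jE : {linear E1 -> E0}) (jH : {linear H1 -> H0}).
Hypothesis jE_le : forall x : E1, nrm (jE x) <= nrm x.
Hypotheses (jH_inj : injective jH) (jH_cont : continuous jH).
Variables (Rad C0 C1 : R) (Phi : E0 -> H0).
Hypothesis Phi_an : forall x : E0, nrm x < Rad -> differentiable Phi x.
Hypothesis Phi_0 : forall x : E0, nrm x < Rad -> nrm (Phi x) <= C0 * nrm x.
Variable Psi : E1 -> H1.
Hypothesis PsiE : forall y : E1, nrm y < Rad -> jH (Psi y) = Phi (jE y).
Hypothesis Psi_1 : forall y : E1, nrm y < Rad -> nrm (Psi y) <= C1 * nrm y.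

(** Restriction to the complex line through [y0] and [y] reduces this to [schwarz_lift]. The
    direction [w] has length [rho], half the distance to the sphere, and [y] sits at the parameter D
    / rho, so [Psi y] and [Psi y0] differ by at most 8 M D / rho. *)
Lemma Psi_continuous (y0 : E1) : nrm y0 < Rad -> {for y0, continuous Psi}.
Proof.
move=> y0R; apply/(cvg_nrm _ _ (nbhs y0) Psi (Psi y0)) => e e0.
pose M := `|C1| * Rad.
have [rho rhoE rho0] : exists2 rho, 2 * rho = Rad - nrm y0 & 0 < rho.
  by exists ((Rad - nrm y0) / 2); lra.
have R0 : 0 < Rad by apply: le_lt_trans y0R; exact: nrm_ge0.
have M0 : 0 <= M by rewrite mulr_ge0// ltW.
have d0 : 0 < e * rho / (8 * M + 1) by rewrite !divr_gt0 ?mulr_gt0//; lra.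
apply/nbhs_nrm; exists (Num.min (rho / 2) (e * rho / (8 * M + 1))).
  by rewrite lt_min d0; lra.
move=> y; rewrite lt_min => /andP[y1 y2].
have [->|yy0] := eqVneq y y0; first by rewrite subrr nrm0.
have d : 0 < nrm (y - y0).
  by apply: nrm_gt0; rewrite subr_eq0.
set D := nrm (y - y0) in d y1 y2.
pose w := ((rho / D)%:C)%C *: (y - y0).
have wn : nrm w = rho by rewrite nrmZ -/D nrmR gtr0_norm ?divr_gt0// divfK// gt_eqF.
pose G (z : R[i]) := Psi (y0 + z *: w).
have inball (z : R[i]) : nrm z < 1 -> nrm (y0 + z *: w) < Rad.
  move=> z1; have := nrmD _ y0 (z *: w); rewrite nrmZ wn.
  have : nrm z * rho <= rho by rewrite ler_piMl// ltW.
  by lra.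
have GM z : nrm z < 1 -> nrm (G z) <= M.
  move=> /inball zB; apply: le_trans (Psi_1 _ zB) _.
  apply: (@le_trans _ _ (`|C1| * nrm (y0 + z *: w))).
    by apply: ler_wpM2r; [exact: nrm_ge0|exact: ler_norm].
  by apply: ler_wpM2l => //; exact: ltW.
have dG z : nrm z < 1 -> differentiable (fun u => jH (G u)) z.
  move=> z1; apply: (near_eq_differentiable _ (fun u : R[i] => Phi (jE y0 + u *: jE w))).
    apply/nbhs_nrm; exists (1 - nrm z); first by rewrite subr_gt0.
    move=> u uz; have u1 : nrm u < 1 by have := nrm_sub_le _ u z; lra.
    by rewrite /G PsiE ?inball// linearD [jE (u *: w)]linearZ_LR.
  apply: (@differentiable_comp _ _ _ _ (fun u : R[i] => jE y0 + u *: jE w) Phi).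
    apply: differentiableD; first exact: differentiable_cst.
    apply: differentiable_scaler; first exact: differentiable_idc.
    exact: differentiable_cst.
  apply: Phi_an; rewrite -[z *: jE w]linearZ_LR -linearD.
  by apply: le_lt_trans (jE_le _) _; exact: inball.
pose z : R[i] := ((D / rho)%:C)%C.
have zn : nrm z = D / rho by rewrite nrmR gtr0_norm// divr_gt0.
have z2 : nrm z <= 2^-1 by rewrite zn ler_pdivrMr//; lra.
have := schwarz_lift _ _ jH jH_inj jH_cont G M GM dG z z2.
rewrite /G scale0r addr0 scalerA -rmorphM/=.
have -> : D / rho * (rho / D) = 1 by field; rewrite !gt_eqF.
rewrite scale1r subrKC zn; move/le_lt_trans; apply.
move: y2; rewrite ltr_pdivlMr; last lra.
by rewrite mulrA ltr_pdivrMr//; lra.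
Qed.

Hypotheses (C0_gt0 : 0 < C0) (C1_gt0 : 0 < C1).
Variable theta : R.
Hypothesis theta01 : 0 <= theta <= 1.

Let lam : R := ln C1 - ln C0.

(* [cweight z = (C1 / C0) ^ (theta - z)] balances the two boundary bounds. *)
Definition cweight (z : R[i]) : R[i] := cexp (((theta%:C)%C - z) * (lam%:C)%C).

Lemma nrm_cweight z : nrm (cweight z) = expR ((theta - complex.Re z) * lam).
Proof. by case: z => a b; rewrite nrm_cexp /= mulr0 subr0. Qed.

Lemma differentiable_cweight z : differentiable cweight z.
Proof.
apply: (@differentiable_comp _ _ _ _ (fun z : R[i] => ((theta%:C)%C - z) * (lam%:C)%C) cexp).
  apply: differentiable_mulc; last exact: differentiable_cst.
  by apply: differentiableB; [exact: differentiable_cst|exact: differentiable_idc].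
exact: differentiable_cexp.
Qed.

Lemma weight0 : expR (theta * lam) * C0 = C0 `^ (1 - theta) * C1 `^ theta.
Proof.
rewrite /powR !gt_eqF// -{1}(lnK (x := C0)) ?posrE// -!expRD; congr expR.
by rewrite /lam; ring.
Qed.

Lemma weight1 : expR ((theta - 1) * lam) * C1 = C0 `^ (1 - theta) * C1 `^ theta.
Proof.
rewrite /powR !gt_eqF// -{1}(lnK (x := C1)) ?posrE// -!expRD; congr expR.
by rewrite /lam; ring.
Qed.

Lemma continuous_complex (a : R) : continuous (fun t : R => Complex a t).
Proof.
move=> t; apply/(cvg_nrm _ _ (nbhs t) _ (Complex a t)) => e e0.
apply/nbhs_ballP; exists e => // s; rewrite /ball/= distrC => st.
have -> : Complex a s - Complex a t = Complex 0 (s - t).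
  by apply/eqP; rewrite eq_complex /= subrr !eqxx.
by rewrite nrmI.
Qed.

Lemma interpolate_bound (f : R[i] -> E0) (nu : R) : nu < Rad -> in_F jE f ->
  (F_norm jE f <= nu%:E)%E -> exists h, [/\ in_F jH h,
    h (theta%:C)%C = Phi (f (theta%:C)%C) &
    (F_norm jH h <= (C0 `^ (1 - theta) * C1 `^ theta * nu)%:E)%E].
Proof.
move=> nuR [[[M fM] fcont fdiff f0cont f0dec] [g [gE gcont gdec]]].
move=> /F_norm_ge[f0 f1].
have g1 t : nrm (g t) <= nu by apply: f1; exact: gE.
(* On the line Re z = 1 only the [E1] norm is bounded by [nu]; the embedding constant 1 in [jE_le]
   passes this bound to [E0] without loss. *)
have fnu z : strip z -> nrm (f z) <= nu.
  apply: (strip_maximum E0 f M) => // t.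
  by rewrite -gE; apply: le_trans (jE_le _) _.
have fR z : strip z -> nrm (f z) < Rad by move=> /fnu h; exact: le_lt_trans nuR.
have gR t : nrm (g t) < Rad by exact: le_lt_trans nuR.
have strip0 t : strip (Complex (0 : R) t) by rewrite /strip/= lexx ler01.
have strip1 t : strip (Complex (1 : R) t) by rewrite /strip/= lexx ler01.
have Phic x : nrm x < Rad -> {for x, continuous Phi}.
  by move=> /Phi_an; exact: differentiable_continuous.
have cc z : {for z, continuous cweight}.
  exact/differentiable_continuous/differentiable_cweight.
have nu0 : 0 <= nu by apply: le_trans (nrm_ge0 _ _) (f0 0).
pose h z := cweight z *: Phi (f z).
pose k t := cweight (Complex 1 t) *: Psi (g t).
have kE t : jH (k t) = h (Complex 1 t).
  by rewrite /k linearZ/= PsiE// gE.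
have w0 t : nrm (cweight (Complex 0 t)) = expR (theta * lam).
  by rewrite nrm_cweight subr0.
have w1 t : nrm (cweight (Complex 1 t)) = expR ((theta - 1) * lam).
  by rewrite nrm_cweight.
pose K := C0 `^ (1 - theta) * C1 `^ theta.
have K0 : 0 < K by rewrite mulr_gt0 ?powR_gt0.
have h0 t : nrm (h (Complex 0 t)) <= K * nrm (f (Complex 0 t)).
  by rewrite /K -weight0 -mulrA nrmZ w0 ler_pM2l ?expR_gt0// Phi_0// fR.
have k1 t : nrm (k t) <= K * nrm (g t).
  by rewrite /K -weight1 -mulrA nrmZ w1 ler_pM2l ?expR_gt0// Psi_1.
exists h; split; last first.
- apply: F_norm_le => [t|t y].
    by apply: le_trans (h0 t) _; rewrite ler_pM2l.
  by rewrite -kE => /jH_inj ->; apply: le_trans (k1 t) _; rewrite ler_pM2l.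
- by rewrite /h /cweight subrr mul0r cexp0 scale1r.
split; last first.
  exists k; split => //.
    move=> t; apply: cvgZ.
      exact: (continuous_comp (continuous_complex 1 t) (cc _)).
    exact: (continuous_comp (gcont t) (Psi_continuous _ (gR t))).
  move=> e e0; have [N NP] := gdec _ (divr_gt0 e0 K0); exists N => t /NP gt.
  by apply: le_lt_trans (k1 t) _; rewrite -ltr_pdivlMl// mulrC.
split.
(* Both theta and Re z lie in [0, 1], so the exponent of the weight is at most |lam|. *)
- exists (expR `|lam| * (C0 * nu)) => z zS.
  rewrite nrmZ nrm_cweight; apply: ler_pM; rewrite ?expR_ge0 ?nrm_ge0//.
    rewrite ler_expR; apply: le_trans (ler_norm _) _; rewrite normrM ler_piMl//.
    by rewrite ler_norml; move: zS theta01; rewrite /strip/=; lra.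
  by apply: le_trans (Phi_0 _ (fR _ zS)) _; rewrite ler_pM2l// fnu.
- apply/subspace_continuousP => z zS; apply: cvgZ.
    exact: cvg_within_filter (cc z).
  move/subspace_continuousP : fcont => /(_ z zS) fz.
  exact: (cvg_comp _ _ fz (Phic _ (fR _ zS))).
- move=> z zS; apply: differentiable_scaler; first exact: differentiable_cweight.
  apply: differentiable_comp; first exact: fdiff.
  by apply/Phi_an/fR; move: zS; rewrite /ostrip /strip/=; lra.
- move=> t; apply: cvgZ.
    exact: (continuous_comp (continuous_complex 0 t) (cc _)).
  exact: (continuous_comp (f0cont t) (Phic _ (fR _ (strip0 t)))).
- move=> e e0; have [N NP] := f0dec _ (divr_gt0 e0 K0); exists N => t /NP ft.
  by apply: le_lt_trans (h0 t) _; rewrite -ltr_pdivlMl// mulrC.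
Qed.

End Nonlinear.

Theorem theorem1 (R : realType) (E0 E1 H0 H1 : completeNormedModType R[i])
  (jE : {linear E1 -> E0}) (jH : {linear H1 -> H0})
  (jE_inj : injective jE) (jE_dense : dense (range jE))
  (jE_le : forall x : E1, nrm (jE x) <= nrm x)
  (jH_inj : injective jH) (jH_cont : continuous jH)
  (jH_dense : dense (range jH))
  (Rad C0 C1 : R) (Rad_gt0 : 0 < Rad) (Phi : E0 -> H0)
  (Phi_an : forall x : E0, nrm x < Rad -> differentiable Phi x)
  (Phi_0 : forall x : E0, nrm x < Rad -> nrm (Phi x) <= C0 * nrm x)
  (Phi_1 : forall y : E1, nrm y < Rad ->
     exists z : H1, jH z = Phi (jE y) /\ nrm z <= C1 * nrm y) :
  forall theta r : R, 0 <= theta <= 1 -> 0 < r < Rad ->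
  forall x : E0, interp_mem jE theta x -> (interp_norm jE theta x < r%:E)%E ->
    interp_mem jH theta (Phi x) /\
    (interp_norm jH theta (Phi x) <=
       (C0 `^ (1 - theta) * C1 `^ theta * (Rad / (Rad - r)))%:E
       * interp_norm jE theta x)%E.
Proof.
move=> theta r theta01 /andP[r0 rR] x _ xr.
(* The lift of [Phi] is made total with the value 0 outside the ball. *)
have /choice[Psi PsiP] : forall y : E1, exists z : H1, nrm y < Rad ->
    jH z = Phi (jE y) /\ nrm z <= C1 * nrm y.
  move=> y; have [/Phi_1[z zP]|yR] := pselect (nrm y < Rad); first by exists z.
  by exists 0.
(* Here [d] pays for making the constants positive, and [nu] for an [f] that only nearly attains the
   infimum. *)
have approx (d nu : R) : 0 < d -> nu <= r -> (interp_norm jE theta x < nu%:E)%E ->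
    exists h, [/\ in_F jH h, h (theta%:C)%C = Phi x & (F_norm jH h <=
      ((C0 `^ (1 - theta) + d) * (C1 `^ theta + d) * nu)%:E)%E].
  move=> d0 nur /interp_norm_lt[f [mu [fF fx fmu munu]]].
  have t0 : 0 <= theta by case/andP: theta01.
  have t1 : 0 <= 1 - theta by rewrite subr_ge0; case/andP: theta01.
  have [C0' [C0'0 C0C0' C0'd]] := powR_approx _ C0 _ _ t1 d0.
  have [C1' [C1'0 C1C1' C1'd]] := powR_approx _ C1 _ _ t0 d0.
  have Phi_0' y : nrm y < Rad -> nrm (Phi y) <= C0' * nrm y.
    by move=> /Phi_0 h; apply: le_trans h _; apply: ler_wpM2r => //; exact: nrm_ge0.
  have PsiE y : nrm y < Rad -> jH (Psi y) = Phi (jE y) by move=> /PsiP[].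
  have Psi_1' y : nrm y < Rad -> nrm (Psi y) <= C1' * nrm y.
    by move=> /PsiP[_ h]; apply: le_trans h _; apply: ler_wpM2r => //; exact: nrm_ge0.
  have muR : mu < Rad by lra.
  have [h [hF hx hmu]] := interpolate_bound _ _ _ _ jE jH jE_le jH_inj jH_cont
    Rad C0' C1' Phi Phi_an Phi_0' Psi PsiE Psi_1' C0'0 C1'0 theta theta01 f mu muR fF fmu.
  exists h; split => //; first by rewrite hx fx.
  apply: le_trans hmu _; rewrite lee_fin.
  have mu0 : 0 <= mu by rewrite -lee_fin; apply: le_trans fmu; exact: F_norm_ge0.
  by apply: ler_pM; rewrite ?mulr_ge0 ?powR_ge0 ?(ltW munu)//;
     apply: ler_pM; rewrite ?powR_ge0.
split.
  by have [h [hF hx _]] := approx 1 r ltr01 (lexx r) xr; exists h.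
have := interp_norm_ge0 _ _ jE theta x.
case E : (interp_norm jE theta x) xr => [n| |]// nr n0.
rewrite lee_fin in n0; rewrite lte_fin in nr.
rewrite -EFinM; apply/lee_addgt0Pr => e e0; rewrite -EFinD.
set A := C0 `^ (1 - theta); set B := C1 `^ theta.
have A0 : 0 <= A by exact: powR_ge0.
have B0 : 0 <= B by exact: powR_ge0.
have AB0 : 0 <= A * B by rewrite mulr_ge0.
(* For 0 < d <= 1, (A + d)(B + d)(n + d) exceeds A B n by at most d S. The last summand 1 only keeps
   [S] positive. *)
pose S := A * B + (A + B + 1) * (n + 1) + 1.
have T0 : 0 <= (A + B + 1) * (n + 1) by rewrite mulr_ge0//; lra.
have S0 : 0 < S by rewrite /S; lra.
(* The bound r - n keeps n + d within [r], as [approx] demands; e / S keeps the total excess below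
   [e]. *)
pose d := Num.min (Num.min 1 (r - n)) (e / S).
have d0 : 0 < d by rewrite !lt_min ltr01 divr_gt0// subr_gt0 nr.
have [[d1 d2] d3] : (d <= 1 /\ d <= r - n) /\ d <= e / S.
  by have : d <= d by []; rewrite {2}/d !le_min => /andP[/andP[-> ->] ->].
have [||h [hF hx hd]] := approx d (n + d) d0; [lra|by rewrite E lte_fin ltrDl|].
apply: (@le_trans _ _ (F_norm jH h)); first by apply: ereal_inf_lbound; exists h.
apply: le_trans hd _; rewrite lee_fin.
have dS : d * S <= e by rewrite -ler_pdivlMr.
have K1 : 1 <= Rad / (Rad - r) by rewrite ler_pdivlMr; lra.
have : A * B * n <= A * B * (Rad / (Rad - r)) * n.
  by apply: ler_wpM2r => //; rewrite -[leLHS]mulr1; exact: ler_wpM2l.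
suff : (A + d) * (B + d) * (n + d) <= A * B * n + d * S by rewrite -/A -/B; lra.
have dd : d * d <= d * 1 by apply: ler_wpM2l => //; exact: ltW.
have h1 : (A + d) * (B + d) <= A * B + d * (A + B + 1) by lra.
apply: le_trans (ler_wpM2r _ h1) _; first by lra.
have h2 : (A + B + 1) * (n + d) <= (A + B + 1) * (n + 1).
  by apply: ler_wpM2l; lra.
have := ler_wpM2l (ltW d0) h2; rewrite /S; lra.
Qed.
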